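(* Let $k>i\geq 1$ be integers. For $n\ge 0$ let $\widetilde{O}_{k,i}(n)$ denote the number of overpartitions $\lambda$ of $n$ such that, for all $t\ge 0$, (1) $f_{\overline{1}}(\lambda)+f_2(\lambda)\leq i-1$; (2) $f_{2t}(\lambda)+f_{\overline{2t}}(\lambda)+f_{\overline{2t+1}}(\lambda)+f_{2t+2}(\lambda)\leq k-1$; (3) if $f_{2t+1}(\lambda)\geq 1$, then $f_{2t+2}(\lambda)\leq k-2$; (4) if $f_{2t}(\lambda)+f_{\overline{2t}}(\lambda)+f_{\overline{2t+1}}(\lambda)+f_{2t+2}(\lambda)=k-1$, then $tf_{2t}(\lambda)+tf_{\overline{2t}}(\lambda)+tf_{\overline{2t+1}}(\lambda)+(t+1)f_{2t+2}(\lambda)\equiv V_{2t+1}(\lambda)+i-1\pmod 2$; (5) if $f_{2t+1}(\lambda)\geq 1$ and $f_{2t+2}(\lambda)=k-2$, then $t+(t+1)f_{2t+2}(\lambda)\equiv V_{2t+1}(\lambda)+i-1\pmod 2$. Let $\widetilde{P}_{k,i}(n)$ denote the number of overpartitions of $n$ whose non-overlined parts are not congruent to $0,\pm(2i-1)$ modulo $4k-4$ (overlined parts are unrestricted). Then, for all $n\geq 0$, $$\widetilde{O}_{k,i}(n)=\widetilde{P}_{k,i}(n).$$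
   Context: An overpartition of $n$ is a partition of $n$ in which the first occurrence of each number may be overlined (so each overlined part $\overline{t}$ occurs at most once). For an overpartition $\lambda$ and $t\ge1$, $f_t(\lambda)$ is the number of non-overlined parts equal to $t$, and $f_{\overline{t}}(\lambda)\in\{0,1\}$ is the number of overlined parts $\overline{t}$; $f_0=f_{\overline{0}}=0$. $V_s(\lambda)$ is the number of overlined parts of $\lambda$ of size not exceeding $s$. *)

(* Defs.v *)
From HB Require Import structures.
From mathcomp Require Import all_boot all_order all_algebra.
From mathcomp Require Import boolp.

Set Implicit Arguments.
Unset Strict Implicit.
Unset Printing Implicit Defensive.

(* A part is a pair (size, is it overlined?); an overpartition is the list of
   its parts in weakly decreasing order.  [part_ge p q] says that [q] may come
   immediately after [p]: among equal sizes only the first one may be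
   overlined, so a part following one of the same size is not overlined. *)
Definition part_ge (p q : nat * bool) : bool :=
  (q.1 < p.1) || ((q.1 == p.1) && ~~ q.2).

Definition is_overpartition (n : nat) (s : seq (nat * bool)) : bool :=
  [&& sorted part_ge s, all (fun p => 0 < p.1) s & \sum_(p <- s) p.1 == n].

Record overpartition (n : nat) : Type := Overpartition {
  parts :> seq (nat * bool);
  partsP : is_overpartition n parts
}.

HB.instance Definition _ n := [isSub for @parts n].
HB.instance Definition _ n := [Countable of overpartition n by <:].

(* Finiteness: an overpartition of n has at most n parts, each at most n. *)
Section Finiteness.
Variable n : nat.

Definition overpartition_code (l : overpartition n) :
    n.-bseq ('I_n.+1 * bool) :=
  insub_bseq n [seq (inord p.1, p.2) | p <- l].

Definition overpartition_decode (b : n.-bseq ('I_n.+1 * bool)) :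
    option (overpartition n) :=
  insub [seq (nat_of_ord p.1, p.2) | p <- b].

Lemma overpartition_codeK : pcancel overpartition_code overpartition_decode.
Proof.
move=> l; rewrite /overpartition_decode /overpartition_code.
have /and3P[_ /allP pos_l /eqP sum_l] := partsP l.
have le_size : size l <= n.
  rewrite -[X in _ <= X]sum_l -sum1_size big_seq [X in _ <= X]big_seq.
  by apply: leq_sum => p /pos_l.
have le_part p : p \in parts l -> p.1 <= n.
  by move=> lp; rewrite -[X in _ <= X]sum_l (big_rem p) //= leq_addr.
rewrite /insub_bseq insubdK; last by rewrite unfold_in size_map.
rewrite -map_comp (_ : map _ _ = parts l) ?valK //.
rewrite -[RHS]map_id; apply/eq_in_map => -[a b] lp /=.
by rewrite inordK // ltnS (le_part _ lp).
Qed.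

HB.instance Definition _ := isFinite.Build (overpartition n)
  (pcan_enumP overpartition_codeK).
End Finiteness.

Definition f (t : nat) (l : seq (nat * bool)) : nat := count_mem (t, false) l.

Definition fbar (t : nat) (l : seq (nat * bool)) : nat := count_mem (t, true) l.

Definition V (s : nat) (l : seq (nat * bool)) : nat :=
  count (fun p => p.2 && (p.1 <= s)) l.

(* All subtractions below are exact when k > i >= 1. *)
Definition O_condition (k i : nat) (l : seq (nat * bool)) : Prop :=
  forall t : nat,
  [/\ fbar 1 l + f 2 l <= i - 1,
      f (2 * t) l + fbar (2 * t) l + fbar (2 * t + 1) l + f (2 * t + 2) l
        <= k - 1,
      f (2 * t + 1) l >= 1 -> f (2 * t + 2) l <= k - 2,
      f (2 * t) l + fbar (2 * t) l + fbar (2 * t + 1) l + f (2 * t + 2) l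
        = k - 1 ->
      t * f (2 * t) l + t * fbar (2 * t) l + t * fbar (2 * t + 1) l
        + (t + 1) * f (2 * t + 2) l = V (2 * t + 1) l + i - 1 %[mod 2]
    & f (2 * t + 1) l >= 1 -> f (2 * t + 2) l = k - 2 ->
      t + (t + 1) * f (2 * t + 2) l = V (2 * t + 1) l + i - 1 %[mod 2]].

Definition O_tilde (k i n : nat) : nat :=
  #|[set l : overpartition n | `[< O_condition k i l >]]|.

Definition P_condition (k i : nat) (l : seq (nat * bool)) : Prop :=
  forall t : nat, (t, false) \in l ->
  [/\ (t%:Z <> 0 %[mod 4 * k%:Z - 4])%Z,
      (t%:Z <> 2 * i%:Z - 1 %[mod 4 * k%:Z - 4])%Z
    & (t%:Z <> - (2 * i%:Z - 1) %[mod 4 * k%:Z - 4])%Z].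

Definition P_tilde (k i n : nat) : nat :=
  #|[set l : overpartition n | `[< P_condition k i l >]]|.

(* Main.v *)
From HB Require Import structures.
Require Import Defs.
From mathcomp Require Import all_boot all_order all_algebra.
From mathcomp Require Import boolp.
From mathcomp Require Import ring zify.
Import GRing.Theory Num.Theory.
Set Implicit Arguments.
Unset Strict Implicit.
Unset Printing Implicit Defensive.

(* Cut an overpartition into levels t = 0, 1, 2, ... holding the parts 2t and 2t+1.
   Conditions (1)-(5) say that f_{2t} stays below a cap which is updated from level to
   level, and the parity conditions are absorbed into the parity of the cap.  With
   x = q^{2t} and F_C(x) the generating function of the levels from t on with cap C,
   this gives, for 2 <= C <= k,
     F_C(x) - F_{C-2}(x) = x^{C-2} (1+x)/(1-xq)
       * [F_{k+1-C} + (x+xq) F_{k-C} + x^2 q F_{k-1-C}](x q^2),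
   together with a boundary equation for C = 1.  The solution is, with w = q^{2n},
     F_C(x) = sum_n p_n(x) w (w^{-C} - (xw)^C),
     p_n(x) = (-x;q)_oo/(x;q)_oo (-1)^n x^{(k-1)n} q^{2(k-1)n^2-n}
              (-q;q^2)_n (x;q^2)_n / ((q^2;q^2)_n (-xq;q^2)_n),
   and at x = q^2 the combination (F_i + q F_{i-1})/(1-q) collapses to (-q)_oo/(q)_oo
   times a theta series, evaluated by the Jacobi triple product.

   All series are handled modulo q^N: rational functions of q regular at 0 form a local
   ring, in which infinite sums and products are truncated, and the triple product is
   used in the finite form coming from the q-binomial theorem. *)

Local Open Scope ring_scope.

(** * The q-difference equation and its solution *)

Lemma expr_double_succ (R : pzRingType) (q : R) t : q ^+ (2 * t.+1) = q ^+ (2 * t) * q ^+ 2.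
Proof. by rewrite -exprD; congr (_ ^+ _); lia. Qed.

Section Rational.
Variables (K : fieldType) (q : K).
Hypothesis q_neq0 : q != 0.
Hypothesis qm : forall j, (0 < j)%N -> 1 - q ^+ j != 0.
Hypothesis qp : forall j, (0 < j)%N -> 1 + q ^+ j != 0.
Variables (r T : nat).

Lemma qm_eq j a : (0 < j)%N -> q ^+ j = a -> 1 - a != 0.
Proof. by move=> j_gt0 <-; apply: qm. Qed.

Lemma qp_eq j a : (0 < j)%N -> q ^+ j = a -> 1 + a != 0.
Proof. by move=> j_gt0 <-; apply: qp. Qed.

(* With x = q ^ (2 t), k = r + 1 and w = q ^ (2 n), the part of the generating function
   from level t on, under the constraint f_{2t} < C, turns out to be
     sum_n coef t n * w * (w ^ (- C) - (x w) ^ C).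
   This shape is the ansatz for the q-difference equation [theta_recurrence]; matching
   powers of w forces the ratio of consecutive coefficients, and the equation at C = 1
   forces coef t 0 = (- x; q)_oo / (x; q)_oo, here cut off at q ^ (2 T). *)
Definition ratio_step (x w : K) : K :=
  - (x ^+ r * (w ^+ r) ^+ 2 * (q ^+ 2) ^+ r / q)
  * ((1 + q * w) * (1 - x * w)) / ((1 - q ^+ 2 * w) * (1 + x * q * w)).

Definition coef (t n : nat) : K :=
  (\prod_(2 * t <= s < 2 * T) ((1 + q ^+ s) / (1 - q ^+ s)))
  * \prod_(j < n) ratio_step (q ^+ (2 * t)) (q ^+ (2 * j)).

Lemma coefS t n :
  coef t n.+1 = coef t n * ratio_step (q ^+ (2 * t)) (q ^+ (2 * n)).
Proof. by rewrite /coef big_ord_recr mulrA. Qed.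

Section Shift.
Variables (t n : nat).
Hypothesis tT : (0 < t < T)%N.
Let x := q ^+ (2 * t).
Let w := q ^+ (2 * n).

Let nz_w : w != 0. Proof. by rewrite expf_neq0. Qed.
Let nz_x : x != 0. Proof. by rewrite expf_neq0. Qed.
Let nz1 : 1 - x * q != 0.
Proof. by apply: (@qm_eq (2 * t).+1) => //; rewrite exprSr. Qed.
Let nz2 : 1 - x * w != 0.
Proof. by apply: (@qm_eq (2 * t + 2 * n)); [lia | rewrite exprD]. Qed.
Let nz3 : 1 - x * (w * q ^+ 2) != 0.
Proof. by apply: (@qm_eq (2 * t + (2 * n + 2))); [lia | rewrite exprD (exprD _ (2 * n))]. Qed.
Let nz4 : 1 + x * q * w != 0.
Proof.
by apply: (@qp_eq ((2 * t).+1 + 2 * n)); [lia | rewrite exprD exprSr].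
Qed.
Let nz5 : 1 + x * q ^+ 2 * q * w != 0.
Proof.
by apply: (@qp_eq ((2 * t + 2).+1 + 2 * n)); [lia | rewrite exprD exprSr (exprD _ (2 * t))].
Qed.
Let nz6 : 1 - q ^+ 2 * w != 0.
Proof. by apply: (@qm_eq (2 + 2 * n)); [lia | rewrite exprD]. Qed.

Let nz_wr : w ^+ r != 0. Proof. by rewrite expf_neq0. Qed.
Let nz_Qr : (q ^+ 2) ^+ r != 0. Proof. by rewrite !expf_neq0. Qed.

Lemma coef_shiftS :
  coef t n = (1 + x) / (1 - x * q) * ((1 + x * q * w) / ((1 - x * w) * w ^+ r))
             * coef t.+1 n ->
  coef t n.+1 = (1 + x) / (1 - x * q)
    * ((1 + x * q * (w * q ^+ 2)) / ((1 - x * (w * q ^+ 2)) * (w * q ^+ 2) ^+ r))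
    * coef t.+1 n.+1.
Proof.
move=> IH; rewrite !coefS {}IH /ratio_step !expr_double_succ -/x -/w (exprMn _ x) !(exprMn _ w).
move: nz_wr nz_Qr; move: (coef t.+1 n) (x ^+ r) (w ^+ r) ((q ^+ 2) ^+ r).
move=> c X W Q W0 Q0; field.
by rewrite nz5 nz6 q_neq0 Q0 W0 nz3 nz1 nz4 nz2.
Qed.

(** Ties term n+1 at level t to term n at level t+1, so that in the recurrence the increment of
    [theta_err] also becomes a multiple of [coef t.+1 n]. *)
Lemma coef_next :
  coef t n = (1 + x) / (1 - x * q) * ((1 + x * q * w) / ((1 - x * w) * w ^+ r))
             * coef t.+1 n ->
  coef t n.+1 = - ((1 + x) / (1 - x * q) *
     (x ^+ r * (w * q ^+ 2) ^+ r / q * ((1 + q * w) / (1 - q ^+ 2 * w))))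
    * coef t.+1 n.
Proof.
move=> IH; rewrite !coefS {}IH /ratio_step -/x -/w (exprMn _ w).
move: nz_wr; move: (coef t.+1 n) (x ^+ r) (w ^+ r) ((q ^+ 2) ^+ r).
move=> c X W Q W0; field.
by rewrite nz6 q_neq0 nz1 nz4 nz2 W0.
Qed.
End Shift.

(** The substitution x -> x q^2 in p_n(x). At n = 0 it removes the factors s = 2t and s = 2t+1 from
    the product, which requires t < T; the induction on n compares [ratio_step] at x and at x
    q^2. *)
Lemma coef_shift t n (x := q ^+ (2 * t)) (w := q ^+ (2 * n)) : (0 < t < T)%N ->
  coef t n = (1 + x) / (1 - x * q) * ((1 + x * q * w) / ((1 - x * w) * w ^+ r))
             * coef t.+1 n.
Proof.
move=> tT; rewrite {}/w; elim: n => [|n IH].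
  have h1 : 1 - x * q != 0.
    by apply: (@qm_eq (2 * t).+1) => //; rewrite exprSr.
  have h2 : 1 - x != 0 by apply: (@qm_eq (2 * t)) => //; lia.
  rewrite /coef !big_ord0 !mulr1 muln0 expr0 expr1n !mulr1.
  rewrite big_ltn; last lia.
  rewrite big_ltn; last lia.
  rewrite (_ : (2 * t).+2 = 2 * t.+1)%N; last lia.
  rewrite (exprSr q (2 * t)) -/x; move: (\prod_(_ <= _ < _) _) => P.
  by field; rewrite h2 h1.
by rewrite expr_double_succ; apply: coef_shiftS.
Qed.

Definition theta_term (t : nat) (C : int) (n : nat) : K :=
  coef t n * q ^+ (2 * n) *
  ((q ^+ (2 * n)) ^ (- C) - (q ^+ (2 * t)) ^ C * (q ^+ (2 * n)) ^ C).

Definition theta_sum (L t : nat) (C : int) : K := \sum_(n < L) theta_term t C n.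

(* telescoping remainder of the sums truncated at n < L *)
Definition theta_err (L t : nat) (C : int) : K :=
  coef t L * (q ^+ (2 * L)) ^ (1 - C) * (1 - (q ^+ (2 * L)) ^+ 2).

Lemma theta_sumS L t C : theta_sum L.+1 t C = theta_sum L t C + theta_term t C L.
Proof. by rewrite /theta_sum big_ord_recr. Qed.

Lemma theta_sum0 L t : theta_sum L t 0 = 0.
Proof.
rewrite /theta_sum big1 // => n _.
by rewrite /theta_term oppr0 !expr0z mulr1 subrr mulr0.
Qed.

(** Replacing C by -C multiplies w^(-C) - (xw)^C by -x^(-C). This handles the index -1, which the
    recurrence reaches at C = 1 and at C = r+1. *)
Lemma theta_sumN L t C :
  theta_sum L t (- C) = - (q ^+ (2 * t)) ^ (- C) * theta_sum L t C.
Proof.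
rewrite /theta_sum mulr_sumr; apply: eq_bigr => n _; rewrite /theta_term opprK.
have xC : (q ^+ (2 * t)) ^ (- C) * (q ^+ (2 * t)) ^ C = 1.
  by rewrite -expfzDr ?expf_neq0 // addNr expr0z.
rewrite -[in LHS](mul1r ((q ^+ (2 * n)) ^ C)) -xC.
by ring.
Qed.

(** Proved term by term in n: the increment of [theta_err] from n to n+1 is what the n-th terms
    lack, and [theta_err] at 0 vanishes because of its factor 1 - w^2. *)
Lemma theta_recurrence L t C (x := q ^+ (2 * t)) : (0 < t < T)%N ->
  theta_sum L t C - theta_sum L t (C - 2) + theta_err L t C =
  x ^ (C - 2) * (1 + x) / (1 - x * q) *
  (theta_sum L t.+1 (r%:Z + 2 - C) + (x + x * q) * theta_sum L t.+1 (r%:Z + 1 - C)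
   + x ^+ 2 * q * theta_sum L t.+1 (r%:Z - C)).
Proof.
move=> tT; elim: L => [|n IH].
  rewrite /theta_sum !big_ord0 /theta_err muln0 expr0 expr1n.
  by rewrite !subrr !mulr0 !addr0 mulr0.
rewrite !theta_sumS.
suff E : theta_term t C n - theta_term t (C - 2) n + theta_err n.+1 t C
         - theta_err n t C =
  x ^ (C - 2) * (1 + x) / (1 - x * q) *
  (theta_term t.+1 (r%:Z + 2 - C) n
   + (x + x * q) * theta_term t.+1 (r%:Z + 1 - C) n
   + x ^+ 2 * q * theta_term t.+1 (r%:Z - C) n).
  rewrite !mulrDr -!mulrDr in IH E *.
  transitivity (theta_sum n t C - theta_sum n t (C - 2) + theta_err n t C
    + (theta_term t C n - theta_term t (C - 2) n + theta_err n.+1 t C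
         - theta_err n t C)); first by ring.
  by rewrite IH E; ring.
rewrite /theta_term /theta_err (coef_next tT (coef_shift n tT)).
rewrite (coef_shift n tT) -/x !expr_double_succ -/x.
set w := q ^+ (2 * n); have nz_x : x != 0 by rewrite expf_neq0.
have nz_w : w != 0 by rewrite expf_neq0.
have h1 : 1 - x * q != 0 by apply: (@qm_eq (2 * t).+1) => //; rewrite exprSr.
have h2 : 1 - x * w != 0.
  by apply: (@qm_eq (2 * t + 2 * n)); [lia | rewrite exprD].
have h3 : 1 - q ^+ 2 * w != 0.
  by apply: (@qm_eq (2 + 2 * n)); [lia | rewrite exprD].
(* [q ^+ 2] is hidden behind [Q] while powers with symbolic exponents are split and generalized; it
   is restored before [field]. *)
have [Q hQ] : {Q | Q = q ^+ 2} by exists (q ^+ 2).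
have nz_q2 : Q != 0 by rewrite hQ expf_neq0.
rewrite -hQ !opprB !(@expfzMl _ w) !(@expfzMl _ x) !expfzDr // -!invr_expz.
rewrite -!exprnP !(exprMn _ w) !expr1 !(exprD _ r) ?expr1.
move: (expfz_neq0 C nz_x) (expfz_neq0 C nz_w) (expfz_neq0 C nz_q2).
move: (expf_neq0 r nz_x) (expf_neq0 r nz_w) (expf_neq0 r nz_q2).
move: (coef t.+1 n) (x ^ C) (w ^ C) (Q ^ C) (x ^+ r) (w ^+ r) (Q ^+ r).
move=> c xC wC qC xr wr qr xr0 wr0 qr0 xC0 wC0 qC0; rewrite hQ.
field.
by rewrite wC0 qC0 xC0 wr0 nz_w h1 nz_x h2 h3 q_neq0.
Qed.
End Rational.

(** * The cap automaton *)

(* With a = f_{2t}, b = f_{bar 2t} + f_{bar 2t+1} and o = f_{2t+1}, conditions (2)-(5) at t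
   amount to f_{2t+2} < next_cap k C a b o, where f_{2t} < C was the constraint from the
   previous step.  The parity V_{2t-1} + i - 1 + (t - 1) (k - 1) is that of C - 1, so
   that no further state is needed; C = 0 encodes an unsatisfiable constraint. *)
Definition next_cap (k C a b o : nat) : nat :=
  (k - maxn (a + b) (0 < o) - odd (maxn (a + b) (0 < o) + b + C + 1))%N.

Section Gf.
Variables (K : fieldType) (q : K) (r B : nat).

Definition part_weight (t a o : nat) (be ga : bool) : nat :=
  (2 * t * a + 2 * t * be + (2 * t).+1 * ga + (2 * t).+1 * o)%N.

(** [f] levels remain to be read, from level [t] on; [C] caps f_{2t} and [B] bounds f_{2t+1}. After
    the last level the next even multiplicity is 0, which is legal exactly when the cap is
    positive. *)
Fixpoint cap_gf (f C t : nat) : K :=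
  if f is f'.+1 then
    \sum_(a < C) \sum_(be : bool) \sum_(ga : bool) \sum_(o < B)
      q ^+ part_weight t a o be ga
      * cap_gf f' (next_cap r.+1 C a (be + ga) o) t.+1
  else (0 < C)%:R.

Definition level_sum (f C t a : nat) : K :=
  \sum_(be : bool) \sum_(ga : bool) \sum_(o < B)
    q ^+ part_weight t a o be ga
    * cap_gf f (next_cap r.+1 C a (be + ga) o) t.+1.

Definition geom (t : nat) : K := \sum_(o < B) (q ^+ (2 * t).+1) ^+ o.

(** [next_cap] depends on the current cap only through its parity. *)
Lemma level_sumSS f C t a : level_sum f C.+2 t a = level_sum f C t a.
Proof.
apply: eq_bigr => be _; apply: eq_bigr => ga _; apply: eq_bigr => o _.
by congr (_ * cap_gf _ _ _); rewrite /next_cap; lia.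
Qed.

(** If the next cap ignores [o], the sum over [o] factors out as [geom], and the choices with b = 0,
    1, 2 overlined parts weigh 1, x + xq and x^2 q. *)
Lemma level_sum_uniform f C t a k' (x := q ^+ (2 * t)) :
  (forall b o, (b <= 2)%N -> next_cap r.+1 C a b o = (k' - b)%N) ->
  level_sum f C t a = x ^+ a * geom t *
    (cap_gf f k' t.+1 + (x + x * q) * cap_gf f (k' - 1) t.+1
     + x ^+ 2 * q * cap_gf f (k' - 2) t.+1).
Proof.
move=> hn; rewrite /level_sum.
transitivity (\sum_(be : bool) \sum_(ga : bool)
   x ^+ a * x ^+ be * (x * q) ^+ ga * geom t * cap_gf f (k' - (be + ga)) t.+1).
  apply: eq_bigr => be _; apply: eq_bigr => ga _.
  rewrite /geom mulr_sumr mulr_suml; apply: eq_bigr => o _.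
  rewrite hn; last by case: be ga => [] [].
  rewrite -exprSr -!exprM -!exprD; congr (q ^+ _ * _); rewrite /part_weight; lia.
by rewrite !big_bool /= !addn0 subn0 add0n; ring.
Qed.

(** Raising the cap by 2 leaves the contributions of a < C unchanged and adds a = C and a = C+1. The
    parity correction makes both lead to the next cap r - C - b, whatever [o] is. *)
Lemma cap_gf_step f C t (x := q ^+ (2 * t)) : (C < r)%N ->
  cap_gf f.+1 C.+2 t = cap_gf f.+1 C t + (x ^+ C + x ^+ C.+1) * geom t *
    (cap_gf f (r - C) t.+1 + (x + x * q) * cap_gf f (r - C - 1) t.+1
     + x ^+ 2 * q * cap_gf f (r - C - 2) t.+1).
Proof.
move=> Cr.
have E C' : cap_gf f.+1 C' t = \sum_(a < C') level_sum f C' t a by [].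
rewrite !E !big_ord_recr /= -addrA.
under eq_bigr => a _ do rewrite level_sumSS.
congr (_ + _).
rewrite !(@level_sum_uniform _ _ _ _ (r - C)).
- by rewrite -/x; ring.
- by move=> b o b2; rewrite /next_cap; case: o => [|o]; lia.
- by move=> b o b2; rewrite /next_cap; case: o => [|o]; lia.
Qed.

(** At cap 1 only a = 0 is possible, and here [o] matters: for b = 0 the next cap is r+1 if o = 0
    and r-1 if o > 0, whence the split of [geom] into 1 and [geom t - 1]. *)
Lemma cap_gf1 f t (x := q ^+ (2 * t)) : (0 < r)%N -> (0 < B)%N ->
  cap_gf f.+1 1 t = cap_gf f r.+1 t.+1 + (geom t - 1) * cap_gf f r.-1 t.+1
    + geom t * ((x + x * q) * cap_gf f r t.+1 + x ^+ 2 * q * cap_gf f r.-1 t.+1).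
Proof.
move=> r_gt0 B_gt0.
have next0 b o : (b <= 2)%N ->
    next_cap r.+1 1 0 b o
    = if b == 0%N then if o == 0%N then r.+1 else r.-1 else (r.+1 - b)%N.
  by move=> b2; rewrite /next_cap; case: b b2 => [|b] _; case: o => [|o] /=; lia.
have -> : cap_gf f.+1 1 t = level_sum f 1 t 0.
  by rewrite /= big_ord_recl big_ord0 addr0.
have S (be ga : bool) k' : (forall o, next_cap r.+1 1 0 (be + ga) o = k') ->
   \sum_(o < B) q ^+ part_weight t 0 o be ga
     * cap_gf f (next_cap r.+1 1 0 (be + ga) o) t.+1
   = x ^+ be * (x * q) ^+ ga * geom t * cap_gf f k' t.+1.
  move=> h; rewrite /geom mulr_sumr mulr_suml; apply: eq_bigr => o _.
  rewrite h -exprSr -!exprM -!exprD.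
  congr (q ^+ _ * _); rewrite /part_weight; lia.
rewrite /level_sum !big_bool.
rewrite (S true true r.-1); last by move=> o; rewrite next0 //=; lia.
rewrite (S true false r); last by move=> o; rewrite next0 //=; lia.
rewrite (S false true r); last by move=> o; rewrite next0 //=; lia.
have -> : \sum_(o < B) q ^+ part_weight t 0 o false false
     * cap_gf f (next_cap r.+1 1 0 (false + false) o) t.+1
   = cap_gf f r.+1 t.+1 + (geom t - 1) * cap_gf f r.-1 t.+1.
  rewrite /geom; case: B B_gt0 => // B' _; rewrite !big_ord_recl /= next0 //=.
  rewrite expr0 addrAC subrr add0r /part_weight !muln0 expr0 mul1r mulr_suml.
  congr (_ + _); apply: eq_bigr => o _; rewrite next0 //=.
  by rewrite -exprM !add0n.
by rewrite /= !expr0 !expr1; ring.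
Qed.
End Gf.

(** * Congruences modulo powers of q *)

Section Congruence.
Variables (K : fieldType) (q : K) (O : subringClosed K).
Hypothesis q_neq0 : q != 0.
Hypothesis Oq : q \in O.

(* q-adic valuation at least N *)
Definition vge (N : nat) (a : K) := a / q ^+ N \in O.

Lemma vge0 N : vge N 0. Proof. by rewrite /vge mul0r rpred0. Qed.

Lemma vgeO a : vge 0 a = (a \in O). Proof. by rewrite /vge divr1. Qed.

Lemma vgeD N a b : vge N a -> vge N b -> vge N (a + b).
Proof. by move=> ha hb; rewrite /vge mulrDl rpredD. Qed.

Lemma vgeN N a : vge N a -> vge N (- a).
Proof. by rewrite /vge mulNr rpredN. Qed.

Lemma vgeM N M a b : vge N a -> vge M b -> vge (N + M) (a * b).
Proof. by move=> ha hb; rewrite /vge exprD invfM mulrACA rpredM. Qed.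

Lemma vgeMr N a b : vge N a -> b \in O -> vge N (a * b).
Proof. by rewrite -vgeO => ha hb; rewrite -[N]addn0; apply: vgeM. Qed.

Lemma vgeMl N a b : b \in O -> vge N a -> vge N (b * a).
Proof. by move=> hb ha; rewrite mulrC vgeMr. Qed.

Lemma vge_sum N (I : Type) (s : seq I) (P : pred I) (F : I -> K) :
  (forall i, P i -> vge N (F i)) -> vge N (\sum_(i <- s | P i) F i).
Proof.
by move=> h; elim/big_ind: _ => // [|a b]; [apply: vge0 | apply: vgeD].
Qed.

Lemma vgeX N M : (N <= M)%N -> vge N (q ^+ M).
Proof. by move=> NM; rewrite /vge -(subnK NM) exprD mulfK ?expf_neq0 ?rpredX. Qed.

Lemma vge_leq N M a : (N <= M)%N -> vge M a -> vge N a.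
Proof.
move=> NM h; rewrite /vge; have -> : a / q ^+ N = a / q ^+ M * q ^+ (M - N).
  rewrite -[in q ^+ M](subnK NM) exprD invfM mulrAC mulrA.
  by rewrite mulfK ?expf_neq0 // mulrC mulrA divfK ?expf_neq0.
by rewrite rpredM ?rpredX.
Qed.

Lemma vge_in N a : vge N a -> a \in O.
Proof. by rewrite -vgeO; apply: vge_leq. Qed.

Definition eqq N a b := vge N (a - b).

Lemma eqq_refl N a : eqq N a a. Proof. by rewrite /eqq subrr vge0. Qed.

Lemma eqq_sym N a b : eqq N a b -> eqq N b a.
Proof. by move=> h; rewrite /eqq -opprB vgeN. Qed.

Lemma eqq_trans N b a c : eqq N a b -> eqq N b c -> eqq N a c.
Proof. by move=> h k; rewrite /eqq -(subrKA b) vgeD. Qed.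

Lemma eqqD N a b c d : eqq N a b -> eqq N c d -> eqq N (a + c) (b + d).
Proof. by move=> h k; rewrite /eqq opprD addrACA vgeD. Qed.

Lemma eqqN N a b : eqq N a b -> eqq N (- a) (- b).
Proof. by move=> h; rewrite /eqq -opprD vgeN. Qed.

(** One factor of each product has to lie in [O], because ac - bd = a(c - d) + (a - b)d. *)
Lemma eqqM N a b c d :
  a \in O -> d \in O -> eqq N a b -> eqq N c d -> eqq N (a * c) (b * d).
Proof.
move=> ha hd h k; rewrite /eqq.
have -> : a * c - b * d = a * (c - d) + (a - b) * d by ring.
by apply: vgeD; [apply: vgeMl | apply: vgeMr].
Qed.

Lemma eqqMl N a c d : a \in O -> eqq N c d -> eqq N (a * c) (a * d).
Proof. by move=> ha h; rewrite /eqq -mulrBr vgeMl. Qed.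

Lemma eqq_leq N M a b : (N <= M)%N -> eqq M a b -> eqq N a b.
Proof. exact: vge_leq. Qed.

Lemma eqq_in N a b : eqq N a b -> b \in O -> a \in O.
Proof. by move=> /vge_in h hb; rewrite -(subrK b a) rpredD. Qed.

Lemma eqq_vge N a : vge N a -> eqq N a 0.
Proof. by rewrite /eqq subr0. Qed.

Lemma eqq_sum N (I : Type) (s : seq I) (P : pred I) (F G : I -> K) :
  (forall i, P i -> eqq N (F i) (G i)) ->
  eqq N (\sum_(i <- s | P i) F i) (\sum_(i <- s | P i) G i).
Proof. by move=> h; rewrite /eqq -sumrB; apply: vge_sum. Qed.

Lemma eqq_prod N (I : eqType) (s : seq I) (F G : I -> K) :
  (forall i, i \in s -> G i \in O) ->
  (forall i, i \in s -> eqq N (F i) (G i)) ->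
  eqq N (\prod_(i <- s) F i) (\prod_(i <- s) G i).
Proof.
elim: s => [|i s IH] hG h; first by rewrite !big_nil eqq_refl.
rewrite !big_cons; apply: eqqM.
- by apply: eqq_in (h _ (mem_head _ _)) _; apply: hG (mem_head _ _).
- rewrite big_seq; apply: rpred_prod => j js.
  by rewrite hG // in_cons js orbT.
- exact: h (mem_head _ _).
- by apply: IH => j js; [apply: hG | apply: h]; rewrite in_cons js orbT.
Qed.
End Congruence.

(** * The finite Jacobi triple product *)

Section QBinomial.
Variables (R : comPzRingType) (P : R).

Fixpoint qbin (n j : nat) : R :=
  match n, j with
  | _, 0 => 1
  | 0, _.+1 => 0
  | n'.+1, j'.+1 => qbin n' j' + P ^+ j'.+1 * qbin n' j
  end.

Definition qpoch (n : nat) : R := \prod_(j < n) (1 - P ^+ j.+1).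

Lemma qpoch0 : qpoch 0 = 1. Proof. by rewrite /qpoch big_ord0. Qed.

Lemma qpochS n : qpoch n.+1 = qpoch n * (1 - P ^+ n.+1).
Proof. by rewrite /qpoch big_ord_recr. Qed.

Lemma qbin0 n : qbin n 0 = 1. Proof. by case: n. Qed.

Lemma qbin_small n j : (n < j)%N -> qbin n j = 0.
Proof.
elim: n j => [|n IH] [|j] //= nj.
by rewrite (IH j) // (IH j.+1) ?mulr0 ?addr0 // ltnW.
Qed.

(** Double induction: with denominators cleared, the q-Pascal rule becomes (1 - P^(j+1)) + P^(j+1)
    (1 - P^(n+1)) = 1 - P^(j+n+2). *)
Lemma qbin_poch n j : qbin (j + n) j * qpoch j * qpoch n = qpoch (j + n).
Proof.
elim: j n => [|j IHj] n; first by rewrite qbin0 qpoch0 !mul1r.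
elim: n => [|n IHn].
  have := IHj 0%N; rewrite addn0 qpoch0 !mulr1 => E.
  by rewrite ?addn0 /= (qbin_small (ltnSn j)) mulr0 addr0 qpochS mulrA E.
rewrite addSn /= qpochS mulrDl mulrDl.
have E1 : qbin (j + n.+1) j * (qpoch j * (1 - P ^+ j.+1)) * qpoch n.+1
   = qpoch (j + n.+1) * (1 - P ^+ j.+1) by rewrite -(IHj n.+1); ring.
have E2 : P ^+ j.+1 * qbin (j + n.+1) j.+1 * (qpoch j * (1 - P ^+ j.+1)) * qpoch n.+1
   = qpoch (j + n.+1) * (P ^+ j.+1 * (1 - P ^+ n.+1)).
  by rewrite (addnS j) -addSn -IHn !qpochS; ring.
rewrite E1 E2 [in RHS]qpochS -(addSn j) exprD; ring.
Qed.

(** Without its first factor 1 + z, the product for n+1 is the product for n at zP; the two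
    resulting sums are recombined by the q-Pascal rule. *)
Lemma qbinomial n z :
  \prod_(j < n) (1 + z * P ^+ j) = \sum_(j < n.+1) P ^+ 'C(j, 2) * qbin n j * z ^+ j.
Proof.
elim: n z => [|n IH] z.
  by rewrite big_ord0 big_ord_recl big_ord0 /= !expr0 !mulr1 addr0.
pose a j := P ^+ 'C(j.+1, 2) * qbin n j * z ^+ j.
transitivity ((1 + z) * \sum_(j < n.+1) a j).
  rewrite big_ord_recl expr0 mulr1; congr (_ * _).
  under eq_bigr => j _ do rewrite lift0 exprS mulrA.
  rewrite IH; apply: eq_bigr => j _.
  by rewrite /a binS bin1 exprD exprMn; ring.
transitivity (\sum_(j < n.+2) a j + \sum_(j < n.+1) z * a j).
  have a0 : a n.+1 = 0 by rewrite /a qbin_small // mulr0 mul0r.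
  rewrite [X in _ = X + _]big_ord_recr /= a0 addr0.
  by rewrite -mulr_sumr; ring.
rewrite big_ord_recl [in RHS]big_ord_recl -addrA; congr (_ + _).
  by rewrite /a /= !qbin0.
rewrite -big_split; apply: eq_bigr => j _.
rewrite !lift0 /a /= (binS j.+1 1) bin1 (exprD P) !exprS; ring.
Qed.
End QBinomial.

Section FiniteTripleProduct.
Variables (K : fieldType) (P : K).
Hypothesis P_neq0 : P != 0.
Hypothesis Pm : forall j, 1 - P ^+ j.+1 != 0.

Lemma qpoch_neq0 n : qpoch P n != 0.
Proof. by apply/prodf_neq0 => j _. Qed.

Lemma qbin_sym n j : qbin P (j + n) j = qbin P (j + n) n.
Proof.
apply: (mulIf (qpoch_neq0 j)); apply: (mulIf (qpoch_neq0 n)).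
by rewrite qbin_poch addnC -qbin_poch; ring.
Qed.

Lemma bin2_half n : (2 * 'C(n.+1, 2) = n.+1 * n)%N.
Proof. by rewrite bin2 -[in RHS](odd_double_half (n.+1 * n)) mul2n oddM /= andNb. Qed.

(** This is the q-binomial theorem with 2m+1 factors at -z / P^m. The indices m - n and m + 1 + n
    carry equal Gaussian coefficients; pairing them produces the factor 1 - z^(2n+1). *)
Lemma finite_triple_product m z : z != 0 ->
  \prod_(j < m.+1) (1 - z * P ^+ j) * \prod_(j < m) (1 - P ^+ j.+1 / z)
  = \sum_(n < m.+1) (-1) ^+ n * (P ^+ 'C(n.+1, 2) / z ^+ n) * (1 - z ^+ (2 * n).+1)
      * qbin P (2 * m).+1 (m - n).
Proof.
move=> z0.
have P0 n : P ^+ n != 0 by rewrite expf_neq0.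
have z0' n : z ^+ n != 0 by rewrite expf_neq0.
have mz0 : (- z) ^+ m != 0 by rewrite expf_neq0 ?oppr_eq0.
pose u := - z / P ^+ m.
(* Read backwards, and with a monomial pulled out of each, the first m factors become the factors 1
   - P^(j+1) / z. *)
have E1 : \prod_(j < m) (1 + u * P ^+ j)
    = (- z) ^+ m / P ^+ 'C(m.+1, 2) * \prod_(j < m) (1 - P ^+ j.+1 / z).
  have -> : (- z) ^+ m / P ^+ 'C(m.+1, 2) = \prod_(j < m) (- z / P ^+ j.+1).
    elim: (m) => [|k IH]; first by rewrite big_ord0 bin_small // !expr0 divr1.
    by rewrite big_ord_recr -IH exprSr (binS k.+1) bin1 exprD /=; field; rewrite !P0.
  rewrite -big_split (reindex_inj rev_ord_inj); apply: eq_bigr => j _ /=.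
  rewrite /u; have -> : P ^+ m = P ^+ (m - j.+1) * P ^+ j.+1.
    by rewrite -exprD subnK.
  by field; rewrite z0 !P0.
have E2 : \prod_(j < m.+1) (1 - z * P ^+ j) = \prod_(j < m.+1) (1 + u * P ^+ (m + j)).
  by apply: eq_bigr => j _; rewrite /u exprD; field; rewrite P0.
have := qbinomial P (2 * m).+1 u.
rewrite (_ : (2 * m).+1 = m + m.+1)%N; last lia.
rewrite big_split_ord /= E1 -E2 => E3.
have {E3}-> : \prod_(j < m.+1) (1 - z * P ^+ j) * \prod_(j < m) (1 - P ^+ j.+1 / z)
  = P ^+ 'C(m.+1, 2) / (- z) ^+ m
    * \sum_(j < (m + m.+1).+1) P ^+ 'C(j, 2) * qbin P (m + m.+1) j * u ^+ j.
  by rewrite -E3; field; rewrite mz0 P0.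
rewrite (_ : (m + m.+1).+1 = m.+1 + m.+1)%N //.
rewrite big_split_ord /= mulrDr (reindex_inj rev_ord_inj) /= !mulr_sumr -big_split.
apply: eq_bigr => n _ /=; rewrite subSS.
have nm : (n <= m)%N by rewrite -ltnS.
have -> : qbin P (m + m.+1) (m.+1 + n) = qbin P (m + m.+1) (m - n).
  have -> : (m + m.+1 = (m - n) + (m.+1 + n))%N by lia.
  by rewrite qbin_sym.
move: (qbin _ _ _) => b.
have F1 : P ^+ 'C(m.+1, 2) / (- z) ^+ m * (P ^+ 'C(m - n, 2) * u ^+ (m - n))
    = (-1) ^+ n * (P ^+ 'C(n.+1, 2) / z ^+ n).
  have Ez : (- z) ^+ m = (- z) ^+ n * (- z) ^+ (m - n) by rewrite -exprD subnKC.
  have : P ^+ 'C(m.+1, 2) * P ^+ 'C(m - n, 2) = P ^+ 'C(n.+1, 2) * P ^+ (m * (m - n)).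
    rewrite -!exprD; congr (_ ^+ _).
    have := bin2_half m; have := bin2_half n; have := bin2 (m - n).
    case: (m - n)%N (subnKC nm) => [|d]; first by rewrite addn0 => ->; rewrite bin0n; nia.
    by have := bin2_half d; nia.
  have {}Ez : ((-1) ^+ n * z ^+ n) * (- z) ^+ (m - n) = (- z) ^+ m by rewrite -exprNn Ez.
  rewrite /u expr_div_n -exprM -Ez => Ep; rewrite -[in RHS]invr_sign.
  move: Ep; have : (- z) ^+ (m - n) != 0 by rewrite expf_neq0 ?oppr_eq0.
  have := P0 (m * (m - n))%N; have : (-1) ^+ n != 0 :> K by rewrite signr_eq0.
  move: ((-1) ^+ n) ((- z) ^+ (m - n)) (P ^+ (m * (m - n))) (P ^+ 'C(m.+1, 2)).
  move: (P ^+ 'C(m - n, 2)) (P ^+ 'C(n.+1, 2)) => p1 p2 s y p3 p4 s0 p30 y0 Ep.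
  have {Ep}-> : p2 = p4 * p1 / p3 by rewrite Ep mulfK.
  by field; rewrite p30 s0 y0 z0'.
have F2 : P ^+ 'C(m.+1, 2) / (- z) ^+ m * (P ^+ 'C(m.+1 + n, 2) * u ^+ (m.+1 + n))
    = - ((-1) ^+ n * (P ^+ 'C(n.+1, 2) * z ^+ n.+1)).
  have : P ^+ 'C(m.+1, 2) * P ^+ 'C(m.+1 + n, 2)
      = P ^+ 'C(n.+1, 2) * P ^+ (m * (m.+1 + n)).
    rewrite -!exprD (addSn m n); congr (_ ^+ _).
    by have := bin2_half m; have := bin2_half n; have := bin2_half (m + n); nia.
  rewrite /u expr_div_n -exprM (exprD (- z)) (exprSr (- z)) (exprNn z n) (exprS z n).
  have := P0 (m * (m.+1 + n))%N.
  move: ((-1) ^+ n) (P ^+ (m * (m.+1 + n))) (P ^+ 'C(m.+1, 2)).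
  move: (P ^+ 'C(m.+1 + n, 2)) (P ^+ 'C(n.+1, 2)) => p1 p2 s p3 p4 p30 Ep.
  have {Ep}-> : p2 = p4 * p1 / p3 by rewrite Ep mulfK.
  by field; rewrite p30 mz0.
transitivity (P ^+ 'C(m.+1, 2) / (- z) ^+ m * (P ^+ 'C(m - n, 2) * u ^+ (m - n)) * b
  + P ^+ 'C(m.+1, 2) / (- z) ^+ m * (P ^+ 'C(m.+1 + n, 2) * u ^+ (m.+1 + n)) * b).
  by ring.
rewrite F1 F2 (_ : (2 * n).+1 = n + n.+1)%N; last lia.
by rewrite (exprD z n); field; rewrite z0'.
Qed.
End FiniteTripleProduct.

(** * Evaluation modulo powers of q *)

(* c stands for 2 i - 1 and 4 r for 4 k - 4 *)
Definition allowed (r c s : nat) : bool :=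
  [&& s %% (4 * r) != 0, s %% (4 * r) != c & s %% (4 * r) != 4 * r - c]%N.

Section LocalRing.
Variables (K : fieldType) (q : K) (O : subringClosed K).
Hypothesis q_neq0 : q != 0.
Hypothesis Oq : q \in O.
Hypothesis qm : forall j, (0 < j)%N -> 1 - q ^+ j != 0.
Hypothesis qp : forall j, (0 < j)%N -> 1 + q ^+ j != 0.
Hypothesis Om : forall j, (0 < j)%N -> (1 - q ^+ j)^-1 \in O.
Hypothesis Op : forall j, (0 < j)%N -> (1 + q ^+ j)^-1 \in O.

Let qX_in j : q ^+ j \in O. Proof. exact: rpredX. Qed.

Lemma Om_eq j a : (0 < j)%N -> q ^+ j = a -> (1 - a)^-1 \in O.
Proof. by move=> j_gt0 <-; apply: Om. Qed.

Lemma Op_eq j a : (0 < j)%N -> q ^+ j = a -> (1 + a)^-1 \in O.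
Proof. by move=> j_gt0 <-; apply: Op. Qed.

Lemma geom_series_eqq B s : (0 < s)%N ->
  eqq q O B (\sum_(a < B) (q ^+ s) ^+ a) (1 - q ^+ s)^-1.
Proof.
move=> s0; have y1 : 1 - q ^+ s != 0 by apply: qm.
have -> : \sum_(a < B) (q ^+ s) ^+ a = (1 - (q ^+ s) ^+ B) * (1 - q ^+ s)^-1.
  apply: (mulIf y1); rewrite divfK //.
  by rewrite -(opprB ((q ^+ s) ^+ B)) subrX1; ring.
rewrite /eqq mulrBl mul1r addrAC subrr add0r; apply: vgeN; apply: vgeMr (Om s0).
by rewrite -exprM; apply: vgeX => //; rewrite leq_pmull.
Qed.

Lemma geom_eqq B t : eqq q O B (geom q B t) (1 - q ^+ (2 * t) * q)^-1.
Proof. by rewrite -exprSr; apply: geom_series_eqq. Qed.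

Variable r : nat.
Hypothesis r_gt0 : (0 < r)%N.

(** The valuation comes from x^r / q = q^(2tr-1). The division by (q^2)^c, which is the growth of
    w^c from n to n+1, is absorbed by (q^2)^r as c <= r. *)
Lemma ratio_step_vge t n c : (0 < t)%N -> (c <= r)%N ->
  vge q O t (ratio_step q r (q ^+ (2 * t)) (q ^+ (2 * n)) / (q ^+ 2) ^+ c).
Proof.
move=> t_gt0 cr; rewrite /ratio_step.
set x := q ^+ (2 * t); set w := q ^+ (2 * n).
have -> : - (x ^+ r * (w ^+ r) ^+ 2 * (q ^+ 2) ^+ r / q)
  * ((1 + q * w) * (1 - x * w)) / ((1 - q ^+ 2 * w) * (1 + x * q * w))
  / (q ^+ 2) ^+ c =
  q ^+ (2 * t * r).-1 * (- ((w ^+ r) ^+ 2 * (q ^+ 2) ^+ (r - c)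
   * ((1 + q * w) * (1 - x * w)) * (1 - q ^+ 2 * w)^-1 * (1 + x * q * w)^-1)).
  have -> : x ^+ r = q ^+ (2 * t * r).-1 * q by rewrite -exprM -exprSr prednK //; lia.
  have -> : (q ^+ 2) ^+ r = (q ^+ 2) ^+ (r - c) * (q ^+ 2) ^+ c.
    by rewrite -exprD subnK.
  have : (q ^+ 2) ^+ c != 0 by rewrite !expf_neq0.
  move: ((q ^+ 2) ^+ c) ((q ^+ 2) ^+ (r - c)) (q ^+ _.-1) (w ^+ r) => a b d e a0.
  rewrite invfM; move: ((1 - q ^+ 2 * w)^-1) ((1 + x * q * w)^-1) => u v.
  by field; rewrite a0 q_neq0.
apply: vgeMr; first by apply: vgeX => //; nia.
rewrite rpredN !rpredM ?rpredX ?rpredD ?rpredN ?rpredM ?rpred1 ?rpredX //.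
  by apply: (@Om_eq (2 + 2 * n)); rewrite // (exprD q 2).
by apply: (@Op_eq ((2 * t).+1 + 2 * n)); rewrite // exprD exprSr.
Qed.

Lemma coef_in T t : (0 < t)%N -> coef q r T t 0 \in O.
Proof.
move=> t_gt0; rewrite /coef big_ord0 mulr1 big_seq rpred_prod // => s.
rewrite mem_index_iota => /andP[ts _].
by rewrite rpredM ?rpredD ?rpred1 ?rpredX // Om //; lia.
Qed.

Lemma coef_vge T t n c : (0 < t)%N -> (c <= r)%N ->
  vge q O (n * t) (coef q r T t n / (q ^+ (2 * n)) ^+ c).
Proof.
move=> t_gt0 cr; elim: n => [|n IH].
  by rewrite mul0n vgeO muln0 expr0 expr1n divr1 coef_in.
have h := vgeM IH (ratio_step_vge n t_gt0 cr); rewrite (mulSnr n t).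
by rewrite coefS expr_double_succ exprMn invfM mulrACA.
Qed.

Lemma theta_termE T t C n (x := q ^+ (2 * t)) (w := q ^+ (2 * n)) :
  theta_term q r T t C.+1%:Z n
  = coef q r T t n / w ^+ C * (1 - x ^+ C.+1 * (w ^+ C.+1) ^+ 2).
Proof.
rewrite /theta_term -/x -/w -exprnN -!exprnP.
have w0 : w != 0 by rewrite expf_neq0.
have := expf_neq0 C w0; rewrite !(exprSr w).
move: (x ^+ C.+1) (w ^+ C) (coef _ _ _ _ _) => X W c W0.
by field; rewrite w0 W0.
Qed.

Lemma theta_term_vge T t C n : (0 < t)%N -> (C <= r.+1)%N ->
  vge q O (n * t) (theta_term q r T t C%:Z n).
Proof.
move=> t_gt0; case: C => [_|C Cr].
  by rewrite /theta_term oppr0 !expr0z mulr1 subrr mulr0 vge0.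
rewrite theta_termE; apply: vgeMr; first exact: coef_vge.
by rewrite rpredB ?rpred1 // rpredM ?rpredX.
Qed.

Lemma theta_sum_in T L t C : (0 < t)%N -> (C <= r.+1)%N ->
  theta_sum q r T L t C%:Z \in O.
Proof.
move=> t_gt0 Cr; apply: rpred_sum => n _.
by apply: (vge_in q_neq0 Oq); apply: theta_term_vge.
Qed.

Lemma theta_err_vge T L t C : (0 < t)%N -> (0 < C <= r.+1)%N ->
  vge q O L (theta_err q r T L t C%:Z).
Proof.
move=> t_gt0 /andP[]; case: C => // C _ Cr; rewrite /theta_err.
have -> : 1 - C.+1%:Z = - C%:Z by lia.
rewrite -exprnN.
apply: vgeMr; last by rewrite rpredB ?rpred1 // !rpredX.
apply: (@vge_leq _ _ _ q_neq0 Oq _ (L * t)); first exact: leq_pmulr.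
exact: coef_vge.
Qed.

(** At the last level the product in [coef] has two factors, both 1 modulo q^t, and the terms with n
    > 0 have valuation at least t. The value 1 matches [cap_gf] with no level left and a positive
    cap. *)
Lemma theta_sum_last L t C : (0 < t)%N -> (0 < C <= r.+1)%N -> (0 < L)%N ->
  eqq q O t (theta_sum q r t.+1 L t C%:Z) 1.
Proof.
move=> t_gt0 /andP[C_gt0 Cr]; case: L => // L _.
rewrite /theta_sum big_ord_recl -[X in eqq _ _ _ _ X]addr0.
apply: eqqD; last first.
  apply/eqq_vge/vge_sum => n _.
  apply: vge_leq (theta_term_vge _ _ t_gt0 Cr) => //=.
  by rewrite /bump /= add1n mulSn leq_addr.
case: C C_gt0 Cr => // C _ Cr; rewrite theta_termE /coef big_ord0 mulr1.
rewrite muln0 expr0 !expr1n invr1 !mulr1.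
rewrite -[X in eqq _ _ _ _ X]mulr1; apply: eqqM.
- by have := coef_in t.+1 t_gt0; rewrite /coef big_ord0 mulr1.
- exact: rpred1.
- have h : eqq q O t (\prod_(2 * t <= s < 2 * t.+1) ((1 + q ^+ s) / (1 - q ^+ s)))
                    (\prod_(2 * t <= s < 2 * t.+1) 1).
    apply: eqq_prod => // s; rewrite ?rpred1 // mem_index_iota => /andP[ts _].
    have s0 : (0 < s)%N by lia.
    rewrite /eqq; have -> : (1 + q ^+ s) / (1 - q ^+ s) - 1
       = q ^+ s * (2%:R * (1 - q ^+ s)^-1).
      by field; apply: qm.
    apply: vgeMr; last by rewrite rpredM ?rpred_nat ?Om.
    by apply: vgeX => //; lia.
  by rewrite big1_eq in h.
- rewrite /eqq addrAC subrr add0r; apply: vgeN.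
  by rewrite -exprM; apply: vgeX => //; nia.
Qed.

(** * Agreement of the cap automaton with the theta sums modulo q^N *)

Section Solution.
Variables (N F L B : nat).
Hypothesis NF : (N <= F)%N.
Hypothesis NL : (N <= L)%N.
Hypothesis NB : (N <= B)%N.
Hypothesis L_gt0 : (0 < L)%N.
Hypothesis B_gt0 : (0 < B)%N.

Let theta t (C : nat) := theta_sum q r F.+1 L t C%:Z.
Let gf f C t := cap_gf q r B f C t.

(* For C = r.+1 the recurrence involves the index -1, where the combinatorial
   generating function is 0 but the closed form is - theta_sum 1 / x.  [edge] is
   the resulting correction, x ^ r / q * (1 + x) / (1 - x q) * theta_sum 1 at x = q ^ (2 t). *)
Definition edge (t : nat) : K :=
  q ^+ (2 * t * r).-1 * ((1 + q ^+ (2 * t)) * (1 - q ^+ (2 * t) * q)^-1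
     * theta_sum q r F.+1 L t.+1 1).

Lemma geomV_in t : (1 - q ^+ (2 * t) * q)^-1 \in O.
Proof. by apply: (@Om_eq (2 * t).+1) => //; rewrite exprSr. Qed.

Lemma edge_vge t : (0 < t)%N -> vge q O t (edge t).
Proof.
move=> t_gt0; apply: vgeMr; first by apply: vgeX => //; nia.
rewrite !rpredM ?geomV_in ?rpredD ?rpred1 //.
by have := @theta_sum_in F.+1 L t.+1 1; apply.
Qed.

Lemma theta_rec t C (x := q ^+ (2 * t)) : (0 < t <= F)%N -> (C.+2 <= r)%N ->
  eqq q O N (theta t C + (x ^+ C + x ^+ C.+1) * (1 - x * q)^-1 *
    (theta t.+1 (r - C) + (x + x * q) * theta t.+1 (r - C - 1)
     + x ^+ 2 * q * theta t.+1 (r - C - 2))) (theta t C.+2).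
Proof.
move=> /andP[t_gt0 tF] Cr.
have tT : (0 < t < F.+1)%N by rewrite t_gt0.
have := theta_recurrence q_neq0 qm qp r L C.+2 tT.
have -> : C.+2%:Z - 2 = C by lia.
have -> : r%:Z + 2 - C.+2%:Z = (r - C)%N by lia.
have -> : r%:Z + 1 - C.+2%:Z = (r - C - 1)%N by lia.
have -> : r%:Z - C.+2%:Z = (r - C - 2)%N by lia.
rewrite -/x -!/(theta _ _) -exprnP => E.
have hv : vge q O N (theta_err q r F.+1 L t C.+2).
  by apply: vge_leq NL (theta_err_vge _ _ _ _) => //; lia.
rewrite /eqq; congr (vge q O N _): hv.
apply: (addrI (theta t C.+2 - theta t C)); rewrite E (exprS x C).
by ring.
Qed.

(** At C = r+1 the indices on the right of the recurrence are 1, 0 and -1. By [theta_sumN] the last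
    one contributes -x/q times the first, and this part is moved into [edge]. *)
Lemma theta_rec_top t (x := q ^+ (2 * t)) : (0 < t <= F)%N ->
  eqq q O N (theta t r.-1 + x ^+ r.-1 * (1 + x) * (1 - x * q)^-1 * theta t.+1 1)
    (theta t r.+1 + edge t).
Proof.
move=> /andP[t_gt0 tF].
have tT : (0 < t < F.+1)%N by rewrite t_gt0.
have := theta_recurrence q_neq0 qm qp r L r.+1 tT.
have -> : r.+1%:Z - 2 = r.-1 by lia.
have -> : r%:Z + 2 - r.+1%:Z = 1%N by lia.
have -> : r%:Z + 1 - r.+1%:Z = 0 by lia.
have -> : r%:Z - r.+1%:Z = - 1%:Z by lia.
rewrite theta_sum0 mulr0 addr0 theta_sumN // -exprnN expr1 -/x -!/(theta _ _).
rewrite -exprnP expr_double_succ -/x => E.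
have hv : vge q O N (theta_err q r F.+1 L t r.+1).
  by apply: vge_leq NL (theta_err_vge _ _ _ _) => //; lia.
rewrite /eqq; congr (vge q O N _): hv.
apply: (addrI (theta t r.+1 - theta t r.-1)); rewrite E /edge -/x -/(theta _ _).
have -> : q ^+ (2 * t * r).-1 = x ^+ r.-1 * x / q.
  apply: (mulIf q_neq0); rewrite divfK // -!exprSr -exprM prednK ?prednK //; nia.
have x0 : x != 0 by rewrite expf_neq0.
have h1 : 1 - x * q != 0 by apply: (@qm_eq _ _ qm (2 * t).+1) => //; rewrite exprSr.
by field; rewrite x0 h1 q_neq0.
Qed.

(** At C = 1 the left side of the recurrence is F_1 - F_{-1} = (1 + 1/x) F_1, and 1 + x cancels. *)
Lemma theta_rec1 t (x := q ^+ (2 * t)) : (0 < t <= F)%N ->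
  eqq q O N ((1 - x * q)^-1 * (theta t.+1 r.+1 + (x + x * q) * theta t.+1 r
     + x ^+ 2 * q * theta t.+1 r.-1)) (theta t 1).
Proof.
move=> /andP[t_gt0 tF].
have tT : (0 < t < F.+1)%N by rewrite t_gt0.
have := theta_recurrence q_neq0 qm qp r L 1 tT.
have -> : 1%:Z - 2 = - 1%:Z by lia.
have -> : r%:Z + 2 - 1 = r.+1 by lia.
have -> : r%:Z + 1 - 1 = r by lia.
have -> : r%:Z - 1 = r.-1 by lia.
rewrite theta_sumN // -exprnN expr1 -/x -!/(theta _ _) => E.
have hv : vge q O N (theta_err q r F.+1 L t 1).
  by apply: vge_leq NL (theta_err_vge _ _ (C := 1) _ _) => //; lia.
have x0 : x != 0 by rewrite expf_neq0.
have h1 : 1 - x * q != 0 by apply: (@qm_eq _ _ qm (2 * t).+1) => //; rewrite exprSr.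
have h2 : 1 + x != 0 by apply: (@qp_eq _ _ qp (2 * t)) => //; lia.
rewrite /eqq; have -> : (1 - x * q)^-1 * (theta t.+1 r.+1
    + (x + x * q) * theta t.+1 r + x ^+ 2 * q * theta t.+1 r.-1) - theta t 1
  = theta_err q r F.+1 L t 1 * (x * (1 + x)^-1).
  have -> : theta_err q r F.+1 L t 1 = x^-1 * (1 + x) / (1 - x * q) *
     (theta t.+1 r.+1 + (x + x * q) * theta t.+1 r + x ^+ 2 * q * theta t.+1 r.-1)
     - (1 + x^-1) * theta t 1 by rewrite -E; ring.
  by field; rewrite h1 h2 x0.
apply: vgeMr => //; rewrite rpredM ?rpredX //.
by apply: (@Op_eq (2 * t)) => //; lia.
Qed.

(** Induction from the last level backwards; within a level, caps are reached from 0 and 1 in steps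
    of two. The cap r+1 is carried along with its correction because cap 1 of the preceding level
    uses it. *)
Lemma cap_gf_theta f t : (0 < t)%N -> (t + f = F)%N ->
  (forall C, (C <= r)%N -> eqq q O N (gf f C t) (theta t C))
  /\ eqq q O N (gf f r.+1 t) (theta t r.+1 + edge t).
Proof.
elim: f t => [|f IH] t t_gt0 tfF.
  have tF : t = F by rewrite -tfF addn0.
  have base C : (0 < C <= r.+1)%N -> eqq q O N (gf 0 C t) (theta t C).
    move=> hC; rewrite /theta -tF; apply: eqq_sym.
    apply: (@eqq_leq _ _ _ q_neq0 Oq _ t); first by rewrite tF.
    rewrite /gf /=; case/andP: (hC) => -> _.
    exact: theta_sum_last.
  split=> [[|C] Cr|]; last 1 first.
  - rewrite -[X in eqq _ _ _ X _]addr0; apply: eqqD; first by apply: base; lia.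
    apply/eqq_sym/eqq_vge; apply: (@vge_leq _ _ _ q_neq0 Oq _ t).
      by rewrite tF.
    exact: edge_vge.
  - by rewrite /theta theta_sum0 eqq_refl.
  - by apply: base; lia.
have tF : (0 < t <= F)%N by lia.
have [] := IH t.+1 isT; first by lia.
move=> IHr IHtop.
have hr : eqq q O N (gf f r.+1 t.+1) (theta t.+1 r.+1 + edge t.+1) by [].
have Otheta u C : (0 < u)%N -> (C <= r.+1)%N -> theta u C \in O.
  by move=> u0 Cr; apply: theta_sum_in.
have Ogeom := geomV_in t.
have geomE : eqq q O N (geom q B t) (1 - q ^+ (2 * t) * q)^-1.
  by apply: eqq_leq NB _ => //; apply: geom_eqq.
have Ogeom' : geom q B t \in O by apply: eqq_in geomE Ogeom.
set x := q ^+ (2 * t) in geomE Ogeom.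
have stepC C : (C.+2 <= r)%N -> eqq q O N (gf f.+1 C t) (theta t C) ->
    eqq q O N (gf f.+1 C.+2 t) (theta t C.+2).
  move=> Cr hC; apply: (eqq_trans _ (theta_rec tF Cr)).
  rewrite /gf cap_gf_step; last lia.
  apply: eqqD => //; apply: eqqM.
  - by rewrite rpredM ?rpredD ?rpredX.
  - by rewrite !rpredD ?rpredM ?rpredD ?rpredM ?rpredX ?Otheta //; lia.
  - by apply: eqqMl; rewrite ?rpredD ?rpredX.
  - apply: eqqD; first apply: eqqD; first by apply: IHr; lia.
      by apply: eqqMl; [rewrite rpredD ?rpredM ?rpredX | apply: IHr; lia].
    by apply: eqqMl; [rewrite rpredM ?rpredX | apply: IHr; lia].
have step0 : eqq q O N (gf f.+1 0 t) (theta t 0).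
  by rewrite /gf /= big_ord0 /theta theta_sum0 eqq_refl.
have step1 : eqq q O N (gf f.+1 1 t) (theta t 1).
  rewrite /gf cap_gf1 // -/x -!/(gf _ _ _).
  apply: (eqq_trans _ (theta_rec1 tF)); rewrite -/x.
  set s := (1 - x * q)^-1 in Ogeom geomE *.
  set y := q ^+ (2 * t.+1).
  set Z := y ^+ r.-1 * (1 + y) * (1 - y * q)^-1 * theta t.+2 1.
  have tF1 : (0 < t.+1 <= F)%N by lia.
  have top : eqq q O N (theta t.+1 r.-1 + Z) (theta t.+1 r.+1 + edge t.+1).
    exact: theta_rec_top.
  have edgeE : edge t.+1 = x * q * Z.
    have -> : edge t.+1 = q ^+ (2 * t.+1 * r).-1 * ((1 + y) * (1 - y * q)^-1
      * theta t.+2 1) by [].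
    have -> : q ^+ (2 * t.+1 * r).-1 = x * q * y ^+ r.-1.
      by rewrite -exprM -exprSr -exprD; congr (_ ^+ _); nia.
    by rewrite /Z; ring.
  have hs : s * (1 - x * q) = 1.
    by apply/mulVf/(@qm_eq _ _ qm (2 * t).+1); rewrite ?exprSr.
  have sE : s - 1 = x * q * s by rewrite -{1}hs; ring.
  have OZ : Z \in O.
    by rewrite /Z !rpredM ?rpredX ?rpredD ?rpred1 ?rpredX ?geomV_in ?Otheta.
  (* The two sides differ by xqs times the difference of the sides of [top], because the correction
     [edge t.+1] is xqZ and s - 1 = xqs. *)
  have Er : eqq q O N
      (theta t.+1 r.+1 + edge t.+1 + (s - 1) * theta t.+1 r.-1
       + s * ((x + x * q) * theta t.+1 r + x ^+ 2 * q * theta t.+1 r.-1))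
      (s * (theta t.+1 r.+1 + (x + x * q) * theta t.+1 r + x ^+ 2 * q * theta t.+1 r.-1)).
    rewrite /eqq.
    set d := (X in vge _ _ _ X).
    have -> : d = (x * q * s)
       * (theta t.+1 r.-1 + Z - (theta t.+1 r.+1 + edge t.+1)).
      rewrite -sE edgeE.
      have -> : d = theta t.+1 r.+1 + x * q * Z + (s - 1) * theta t.+1 r.-1
        - s * theta t.+1 r.+1 by rewrite /d edgeE; ring.
      have {1}-> : x * q * Z = (s - 1) * Z - (s - 1) * (x * q * Z).
        by rewrite sE -[LHS]mulr1 -hs; ring.
      by ring.
    by apply: vgeMl => //; rewrite !rpredM ?rpredX.
  apply: eqq_trans Er.
  apply: eqqD; first apply: eqqD => //.
    apply: eqqM; rewrite ?rpredB ?rpred1 ?Otheta //; [by lia| |].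
  - by apply: eqqD => //; apply: eqq_refl.
  - by apply: IHr; lia.
  apply: eqqM => //.
  - by rewrite !rpredD ?rpredM ?rpredD ?rpredM ?rpredX ?Otheta //; lia.
  - apply: eqqD; apply: eqqMl; rewrite ?rpredD ?rpredM ?rpredX //.
      by apply: IHr.
    by apply: IHr; lia.
have all C : (C <= r)%N -> eqq q O N (gf f.+1 C t) (theta t C).
  elim/ltn_ind: C => [[|[|C]]] IHC Cr //.
  by apply: stepC => //; apply: IHC; lia.
split=> //.
apply: (eqq_trans _ (theta_rec_top tF)).
have Er : (r.+1 = r.-1.+2)%N by lia.
(* For cap r+1 the last two indices of [cap_gf_step] are both 0, the second by truncated
   subtraction, where the theta recurrence has 0 and -1. This is the origin of [edge]. *)
have gf0 : gf f 0 t.+1 = 0 by rewrite /gf; case: (f) => [|f'] //=; rewrite big_ord0.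
rewrite {1}/gf Er cap_gf_step; last lia.
rewrite (_ : r - r.-1 = 1)%N ?subnn ?sub0n; last lia.
rewrite -!/(gf _ _ _) gf0 !mulr0 !addr0.
apply: eqqD; first by apply: all; lia.
rewrite exprS -/x (_ : x ^+ r.-1 + x * x ^+ r.-1 = x ^+ r.-1 * (1 + x)); last by ring.
apply: eqqM.
- by rewrite !rpredM ?rpredD ?rpred1 ?rpredX.
- by rewrite Otheta.
- by apply: eqqMl => //; rewrite rpredM ?rpredD ?rpred1 ?rpredX.
- by apply: IHr.
Qed.
End Solution.

(** * Evaluation at x = q^2 by the triple product *)

(** At x = q^2 the factors 1 - xw and 1 - q^2 w of [ratio_step] cancel, and the quotients (1 + qw) /
    (1 + q^3 w) telescope. *)
Lemma coef1E T n :
  coef q r T 1 n = coef q r T 1 0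
    * ((-1) ^+ n * ((q ^+ (4 * r)) ^+ 'C(n.+1, 2) / q ^+ n))
    * ((1 + q) / (1 + q * q ^+ (2 * n))).
Proof.
elim: n => [|n IH].
  rewrite muln0 expr0 mulr1 divff ?mulr1; last by apply: (qp (j := 1)).
  by rewrite bin_small // !expr0 divr1 !mulr1.
rewrite coefS IH /ratio_step muln1.
have h1 : 1 + q * q ^+ (2 * n) != 0 by apply: (@qp_eq _ _ qp (2 * n).+1); rewrite ?exprS.
have h2 : 1 + q * q ^+ (2 * n.+1) != 0.
  by apply: (@qp_eq _ _ qp (2 * n.+1).+1); rewrite ?exprS.
have h3 : 1 - q ^+ 2 * q ^+ (2 * n) != 0.
  by apply: (@qm_eq _ _ qm (2 + 2 * n)); rewrite ?exprD.
have -> : (q ^+ (4 * r)) ^+ 'C(n.+2, 2) = (q ^+ (4 * r)) ^+ 'C(n.+1, 2)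
    * ((q ^+ 2) ^+ r * ((q ^+ (2 * n)) ^+ r) ^+ 2 * (q ^+ 2) ^+ r).
  rewrite (binS n.+1 1) bin1 exprD; congr (_ * _).
  by rewrite -!exprM -!exprD; congr (_ ^+ _); lia.
move: h2; rewrite expr_double_succ => h2.
have qn : q ^+ n != 0 by rewrite expf_neq0.
rewrite !(exprS _ n).
move: (coef _ _ _ _ _) ((q ^+ 2) ^+ r) ((q ^+ (2 * n)) ^+ r) (_ ^+ 'C(_, 2)) ((-1) ^+ n).
move: (q ^+ (2 * n)) h1 h2 h3 (q ^+ n) qn => w h1 h2 h3 v v0 c a b d s.
by field; rewrite h2 v0 q_neq0 h3 h1.
Qed.

(** In each term the two brackets, times w, combine to w^(-C) (1 + qw) (1 - (qw)^(2C+1) / w^0) with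
    w^(2C+1) = (q^(2C+1))^(2n) / q^0 in the theta form; the factor 1 + qw cancels the denominator
    left by [coef1E]. *)
Lemma theta_pair T L C :
  theta_sum q r T L 1 C.+1 + q * theta_sum q r T L 1 C
  = coef q r T 1 0 * (1 + q) * \sum_(n < L) (-1) ^+ n
      * ((q ^+ (4 * r)) ^+ 'C(n.+1, 2) / (q ^+ (2 * C).+1) ^+ n)
      * (1 - (q ^+ (2 * C).+1) ^+ (2 * n).+1).
Proof.
rewrite /theta_sum mulr_sumr -big_split mulr_sumr; apply: eq_bigr => n _ /=.
rewrite theta_termE /theta_term coef1E -exprnN -!exprnP muln1.
set w := q ^+ (2 * n).
have h1 : 1 + q * w != 0 by apply: (@qp_eq _ _ qp (2 * n).+1); rewrite ?exprS.
have w0 : w != 0 by rewrite expf_neq0.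
have -> : (q ^+ (2 * C).+1) ^+ n = w ^+ C * q ^+ n.
  by rewrite -!exprM -exprD; congr (_ ^+ _); lia.
have -> : (q ^+ (2 * C).+1) ^+ (2 * n).+1 = (q ^+ 2) ^+ C * (w ^+ C) ^+ 2 * (q * w).
  by rewrite -!exprM -exprS -!exprD; congr (_ ^+ _); lia.
have := expf_neq0 C w0; have := expf_neq0 n q_neq0.
rewrite !(exprSr _ C).
move: (coef _ _ _ _ _) ((q ^+ 2) ^+ C) (w ^+ C) (_ ^+ 'C(_, 2)) ((-1) ^+ n).
move: (q ^+ n) => v c a b d s v0 b0.
by field; rewrite v0 b0 h1.
Qed.

Lemma qpoch_in d n : (0 < d)%N -> qpoch (q ^+ d) n \in O.
Proof. by move=> d0; apply: rpred_prod => j _; rewrite rpredB ?rpred1 ?rpredX. Qed.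

Lemma qpochV_in d n : (0 < d)%N -> (qpoch (q ^+ d) n)^-1 \in O.
Proof.
move=> d0; rewrite /qpoch -prodfV; apply: rpred_prod => j _.
by rewrite -exprM Om // muln_gt0 d0.
Qed.

Lemma qpoch_stable d a b : (0 < d)%N -> (a <= b)%N ->
  eqq q O a (qpoch (q ^+ d) b) (qpoch (q ^+ d) a).
Proof.
move=> d0 /subnKC <-; elim: (b - a)%N => [|e IH]; first by rewrite addn0 eqq_refl.
rewrite addnS qpochS mulrBr mulr1 -[X in eqq _ _ _ _ X]subr0.
apply: eqqD => //; apply: eqqN; apply/eqq_vge/vgeMl; first exact: qpoch_in.
by rewrite -exprM; apply: vgeX => //; nia.
Qed.

(** By [qbin_poch] the left side is (P)_{2m+1} (P)_m / ((P)_{m-n} (P)_{m+1+n}), and all four factors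
    are congruent to (P)_{m-n}. *)
Lemma qbin_limit d m n : (0 < d)%N -> (n <= m)%N ->
  eqq q O (m - n) (qbin (q ^+ d) (2 * m).+1 (m - n) * qpoch (q ^+ d) m) 1.
Proof.
move=> d0 nm; set P := q ^+ d; set A := qpoch P (m - n).
have Pm j : 1 - P ^+ j.+1 != 0 by rewrite -exprM qm // muln_gt0 d0.
have A0 : A != 0 by apply: qpoch_neq0.
have B0 : qpoch P (m.+1 + n) != 0 by apply: qpoch_neq0.
have := qbin_poch P (m.+1 + n) (m - n).
rewrite (_ : m - n + (m.+1 + n) = (2 * m).+1)%N; last lia.
rewrite -/A => E.
have -> : qbin P (2 * m).+1 (m - n) = qpoch P (2 * m).+1 / (A * qpoch P (m.+1 + n)).
  by rewrite -E; field; rewrite A0 B0.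
have hA b : (m - n <= b)%N -> eqq q O (m - n) (qpoch P b) A by apply: qpoch_stable.
rewrite /eqq.
have -> : qpoch P (2 * m).+1 / (A * qpoch P (m.+1 + n)) * qpoch P m - 1
  = (qpoch P (2 * m).+1 * qpoch P m - A * qpoch P (m.+1 + n))
    * (A^-1 * (qpoch P (m.+1 + n))^-1) by field; rewrite A0 B0.
apply: vgeMr; last by rewrite rpredM // qpochV_in.
apply: (@eqq_trans _ _ _ _ (A * A)).
  by apply: eqqM; rewrite ?qpoch_in //; apply: hA; lia.
by apply: eqqMl; rewrite ?qpoch_in //; apply: eqq_sym; apply: hA; lia.
Qed.

(** The precision m - n of [qbin_limit] drops with n, but the n-th term itself has valuation at
    least n because c < 2r. *)
Lemma triple_product_limit c m (P := q ^+ (4 * r)) (z := q ^+ c) : (c < 2 * r)%N ->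
  eqq q O m
    (\sum_(n < m.+1) (-1) ^+ n * (P ^+ 'C(n.+1, 2) / z ^+ n) * (1 - z ^+ (2 * n).+1))
    (qpoch P m * (\prod_(j < m.+1) (1 - z * P ^+ j)
                 * \prod_(j < m) (1 - P ^+ j.+1 / z))).
Proof.
move=> cr; have d0 : (0 < 4 * r)%N by lia.
rewrite finite_triple_product; first last.
- by rewrite expf_neq0.
- by move=> j; rewrite -exprM qm // muln_gt0 d0.
- by rewrite expf_neq0.
rewrite mulr_sumr; apply: eqq_sum => n _.
have nm : (n <= m)%N by rewrite -ltnS.
have h := eqq_sym (qbin_limit d0 nm).
rewrite /eqq.
set b := qbin _ _ _ in h *; set v := P ^+ _ / _.
have -> : (-1) ^+ n * v * (1 - z ^+ (2 * n).+1)
  - qpoch P m * ((-1) ^+ n * v * (1 - z ^+ (2 * n).+1) * b)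
  = v * (1 - b * qpoch P m) * ((-1) ^+ n * (1 - z ^+ (2 * n).+1)) by ring.
apply: vgeMr; last by rewrite rpredM ?rpredB ?rpred1 ?rpredX ?rpredN ?rpred1.
rewrite -[X in vge _ _ X _](subnKC nm); apply: vgeM => //.
have -> : v = q ^+ (4 * r * 'C(n.+1, 2) - c * n).
  apply: (mulIf (expf_neq0 n (expf_neq0 c q_neq0))); rewrite divfK ?expf_neq0 //.
  rewrite -!exprM -exprD subnK //.
  by have := bin2_half n; nia.
by apply: vgeX => //; have := bin2_half n; nia.
Qed.

Definition sieve (c s : nat) : K := if allowed r c s then 1 else 1 - q ^+ s.

(** Since 0 < c < 2r, the residues 0, c and 4r - c are distinct, and each occurs once in the
    block. *)
Lemma block_prod (R : comPzRingType) (G : nat -> R) c j : (0 < c < 2 * r)%N ->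
  (forall s, allowed r c s -> G s = 1) ->
  \prod_(j * (4 * r) <= s < j.+1 * (4 * r)) G s
  = G (j * (4 * r))%N * (G (j * (4 * r) + c)%N * G (j.+1 * (4 * r) - c)%N).
Proof.
move=> /andP[c0 cr] G1.
have d0 : (0 < 4 * r)%N by lia.
rewrite -{1}(add0n (j * (4 * r))%N) big_addn mulSn addnK big_mkord.
have h1 : (c < 4 * r)%N by lia.
have h2 : (4 * r - c < 4 * r)%N by lia.
rewrite (bigD1 (Ordinal d0)) //= (bigD1 (Ordinal h1)) /=; last by rewrite -val_eqE /=; lia.
rewrite (bigD1 (Ordinal h2)) /=; last by rewrite -!val_eqE /=; lia.
rewrite big1 ?mulr1; last first.
  move=> u; rewrite -!val_eqE /= => hu; apply: G1.
  by rewrite /allowed (addnC _ (j * _)) modnMDl modn_small // andbA hu.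
by congr (G _ * (G _ * G _)); lia.
Qed.

Lemma sieve_prod c m (P := q ^+ (4 * r)) (z := q ^+ c) : (0 < c < 2 * r)%N ->
  \prod_(1 <= s < m.+1 * (4 * r)) sieve c s
  = qpoch P m * (\prod_(j < m.+1) (1 - z * P ^+ j) * \prod_(j < m.+1) (1 - P ^+ j.+1 / z)).
Proof.
move=> hc; have [c0 cr] := andP hc.
have d0 : (0 < 4 * r)%N by lia.
(* The index 0 is added with value 1, so that the range starts at a block boundary; [sieve] itself
   vanishes there. *)
pose G s := if s == 0%N then 1 else sieve c s.
transitivity (\prod_(0 <= s < m.+1 * (4 * r)) G s).
  rewrite [RHS]big_ltn ?muln_gt0 // {1}/G eqxx mul1r.
  by rewrite !big_nat; apply: eq_bigr => -[].
rewrite big_nat_mul big_mkord.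
have G1 s : allowed r c s -> G s = 1 by rewrite /G /sieve => ->; case: ifP.
under eq_bigr => j _ do rewrite (block_prod _ hc G1).
rewrite !big_split /=; congr (_ * (_ * _)).
- rewrite big_ord_recl [X in X * _]/= mul1r; apply: eq_bigr => j _.
  rewrite lift0 /G muln_eq0 /= (gtn_eqF d0) /sieve /allowed.
  by rewrite modnMl eqxx (mulnC j.+1) exprM.
- apply: eq_bigr => j _; rewrite /G /sieve /allowed modnMDl modn_small; last lia.
  by rewrite eqxx andbF addn_eq0 (gtn_eqF c0) andbF exprD mulrC (mulnC j) exprM.
- apply: eq_bigr => j _; rewrite /G /sieve /allowed.
  have -> : (j.+1 * (4 * r) - c = j * (4 * r) + (4 * r - c))%N by lia.
  rewrite modnMDl modn_small; last lia.
  rewrite eqxx !andbF; have -> : (j * (4 * r) + (4 * r - c) == 0)%N = false by lia.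
  congr (_ - _); apply: (mulIf (expf_neq0 c q_neq0)); rewrite divfK ?expf_neq0 //.
  by rewrite -!exprM -exprD; congr (_ ^+ _); nia.
Qed.

(** The Euler factor of the parts of size s: the overlined one and, if s is allowed, the
    non-overlined ones. *)
Definition gfactor (c s : nat) : K :=
  (1 + q ^+ s) * (if allowed r c s then (1 - q ^+ s)^-1 else 1).

Lemma gfactorE c s : (0 < s)%N ->
  gfactor c s = (1 + q ^+ s) / (1 - q ^+ s) * sieve c s.
Proof.
move=> s0; rewrite /gfactor /sieve; case: ifP => _; rewrite ?mulr1 //.
by rewrite divfK ?qm.
Qed.

Lemma gfactor_in c s : (0 < s)%N -> gfactor c s \in O.
Proof.
move=> s0; rewrite /gfactor rpredM ?rpredD ?rpred1 ?rpredX //.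
by case: ifP => _; rewrite ?rpred1 // Om.
Qed.

Lemma gfactor_eqq1 c s : (0 < s)%N -> eqq q O s (gfactor c s) 1.
Proof.
move=> s0; rewrite /eqq /gfactor; case: ifP => _.
  have -> : (1 + q ^+ s) / (1 - q ^+ s) - 1 = q ^+ s * (2%:R * (1 - q ^+ s)^-1).
    by field; apply: qm.
  by apply: vgeMr; rewrite ?rpredM ?rpred_nat ?Om //; apply: vgeX.
by rewrite mulr1 addrAC subrr add0r; apply: vgeX.
Qed.

(** Level 0 holds only parts 1: [geom] counts the plain ones, and an overlined 1 costs q and lowers
    the initial cap from i = C+1 to C. The condition on [f] makes the cut-off 2(f+2) of [coef] a
    whole number of blocks of length 4r, as [sieve_prod] requires. *)
Lemma O_gf_product N B m f C : (N <= m)%N -> (N <= B)%N -> (0 < B)%N -> (C < r)%N ->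
  (f.+2 = m.+1 * (2 * r))%N ->
  eqq q O N (geom q B 0 * (cap_gf q r B f C.+1 1 + q * cap_gf q r B f C 1))
    (\prod_(1 <= s < 2 * f.+1) gfactor (2 * C).+1 s).
Proof.
move=> Nm NB B0 Cr fE.
set c := (2 * C).+1.
have hc : (0 < c < 2 * r)%N by rewrite /c; lia.
have NF : (N <= f.+1)%N by nia.
have NL : (N <= m.+1)%N by lia.
have [capE _] := cap_gf_theta NF NL NB isT B0 (isT : 0 < 1)%N (add1n f).
have geomE : eqq q O N (geom q B 0) (1 - q)^-1.
  have := geom_eqq B 0; rewrite muln0 expr0 mul1r.
  exact: eqq_leq.
have Oq1 : (1 - q)^-1 \in O by have := Om (j := 1); apply.
have Otheta D : (D <= r)%N -> theta_sum q r f.+2 m.+1 1 D%:Z \in O.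
  by move=> Dr; apply: theta_sum_in => //; lia.
apply: (@eqq_trans _ _ _ _ ((1 - q)^-1 * (theta_sum q r f.+2 m.+1 1 C.+1
    + q * theta_sum q r f.+2 m.+1 1 C))).
  apply: eqqM => //.
  - exact: (eqq_in q_neq0 Oq geomE).
  - by rewrite rpredD ?rpredM ?Otheta //; lia.
  - by apply: eqqD; [apply: capE; lia | apply: eqqMl => //; apply: capE; lia].
rewrite theta_pair.
set P := q ^+ (4 * r); set z := q ^+ c.
set Y := \sum_(n < m.+1) _.
have Pz j : P ^+ j.+1 / z = q ^+ (4 * r * j.+1 - c).
  apply: (mulIf (expf_neq0 c q_neq0)); rewrite divfK ?expf_neq0 //.
  by rewrite -!exprM -exprD subnK //; nia.
have YE : eqq q O N Y (\prod_(1 <= s < m.+1 * (4 * r)) sieve c s).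
  apply: (eqq_leq q_neq0 Oq Nm).
  apply: (eqq_trans (triple_product_limit m _)); first by case/andP: hc.
  (* [sieve_prod] has one factor 1 - P^(m+1) / z more than the triple product; it is 1 modulo
     q^m. *)
  rewrite sieve_prod // [X in eqq _ _ _ _ (_ * (_ * X))]big_ord_recr /=.
  apply: eqqMl; first by apply: qpoch_in; lia.
  apply: eqqMl.
    by apply: rpred_prod => j _; rewrite rpredB ?rpred1 ?rpredM ?rpredX.
  rewrite -[X in eqq _ _ _ X _]mulr1; apply: eqqMl.
    by apply: rpred_prod => j _; rewrite rpredB ?rpred1 // Pz rpredX.
  apply/eqq_sym; rewrite /eqq addrAC subrr add0r; apply: vgeN.
  by rewrite Pz; apply: vgeX => //; nia.
have Ocoef : coef q r f.+2 1 0 \in O by apply: coef_in.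
apply: (@eqq_trans _ _ _ _ ((1 - q)^-1 * (coef q r f.+2 1 0 * (1 + q)
   * \prod_(1 <= s < m.+1 * (4 * r)) sieve c s))).
  by apply/eqqMl/eqqMl; rewrite // rpredM ?rpredD ?rpred1.
have -> : (1 - q)^-1 * (coef q r f.+2 1 0 * (1 + q)
   * \prod_(1 <= s < m.+1 * (4 * r)) sieve c s)
  = \prod_(1 <= s < m.+1 * (4 * r)) gfactor c s.
  under [RHS]eq_big_nat => s hs do rewrite gfactorE ?(andP hs).1 //.
  rewrite big_split /= !mulrA; congr (_ * _).
  rewrite /coef big_ord0 mulr1 (_ : m.+1 * (4 * r) = 2 * f.+2)%N; last lia.
  rewrite [in RHS]big_ltn; last lia.
  by rewrite muln1 expr1 mulrC mulrA mulrAC.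
(* The blocks reach up to 2(f+2), but the levels stop below 2(f+1); the two extra factors are 1
   modulo q^N. *)
rewrite (_ : m.+1 * (4 * r) = (2 * f.+1).+2)%N; last lia.
rewrite big_nat_recr //= big_nat_recr /=; last lia.
rewrite -mulrA -[X in eqq _ _ _ _ X]mulr1.
have Nf j : eqq q O N (gfactor c (2 * f.+1 + j)) 1.
  apply: (@eqq_leq _ _ _ q_neq0 Oq _ (2 * f.+1 + j)); first lia.
  by apply: gfactor_eqq1; lia.
apply: eqqMl.
  rewrite big_nat; apply: rpred_prod => s /andP[s0 _]; exact: gfactor_in.
rewrite -[X in eqq _ _ _ _ X]mulr1; apply: eqqM; rewrite ?rpred1 ?gfactor_in //.
  by have := Nf 0%N; rewrite addn0.
by have := Nf 1%N; rewrite addn1.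
Qed.
End LocalRing.

Local Close Scope ring_scope.

(** * Overpartitions as sequences of levels *)

Lemma part_ge_trans : transitive part_ge.
Proof. by move=> [b b'] [a a'] [c c']; rewrite /part_ge /=; case: a' b' c' => [] [] []; lia. Qed.

Lemma part_ge_anti : antisymmetric part_ge.
Proof.
move=> [a a'] [b b']; rewrite /part_ge /= => h.
have ab : a = b by lia.
by subst b; congr (_, _); case: a' b' h => [] []; lia.
Qed.

Section Overpartition.
Variables (N : nat) (l : overpartition N).

Lemma f_large s : N < s -> f s l = 0.
Proof.
move=> Ns; apply/count_memPn; apply/negP => ls.
have /and3P[_ _ /eqP] := partsP l; rewrite (big_rem _ ls) /=; lia.
Qed.

Lemma fbar_large s : N < s -> fbar s l = 0.
Proof.
move=> Ns; apply/count_memPn; apply/negP => ls.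
have /and3P[_ _ /eqP] := partsP l; rewrite (big_rem _ ls) /=; lia.
Qed.

Lemma f_zero : f 0 l = 0.
Proof.
apply/count_memPn; apply/negP => ls.
by have /and3P[_ /allP /(_ _ ls)] := partsP l.
Qed.

Lemma fbar_zero : fbar 0 l = 0.
Proof.
apply/count_memPn; apply/negP => ls.
by have /and3P[_ /allP /(_ _ ls)] := partsP l.
Qed.

Lemma fbar_le1 s : fbar s l <= 1.
Proof.
have /and3P[+ _ _] := partsP l; rewrite (sorted_pairwise part_ge_trans) /fbar.
elim: (parts l) => //= p l' IH /andP[/allP pl' /IH]; case: eqP => //= ->{p} in pl' *.
suff /count_memPn-> : (s, true) \notin l' by [].
by apply/negP => /pl'; rewrite /part_ge /= ltnn andbF.
Qed.

Lemma f_le s : f s l <= N.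
Proof.
have /and3P[_ /allP pos /eqP sumN] := partsP l.
apply: (leq_trans (count_size _ _)); rewrite -[X in _ <= X]sumN -sum1_size.
by rewrite big_seq [X in _ <= X]big_seq; apply: leq_sum => p /pos.
Qed.

End Overpartition.

Lemma V0 l : V 0 l = fbar 0 l.
Proof.
by apply: eq_count => -[s []] /=; rewrite xpair_eqE /=; lia.
Qed.

Lemma VS s l : V s.+1 l = V s l + fbar s.+1 l.
Proof.
rewrite /V /fbar; elim: l => //= -[u b] l ->.
by rewrite xpair_eqE /=; case: b; rewrite ?andbF ?andbT //=; lia.
Qed.

(** The parity conditions concern only the largest a' left by the inequalities, k - 1 - max(a + b,
    [o > 0]); [next_cap] excludes it when its parity differs from [e]. *)
Lemma cap_step (k C a b o a' : nat) (e : bool) : 1 < k -> 0 < C ->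
  e = odd (C.-1 + b + k.-1) ->
  [/\ a + b + a' <= k - 1, o >= 1 -> a' <= k - 2,
      a + b + a' = k - 1 -> odd a' = e & o >= 1 -> a' = k - 2 -> odd a' = e]
  <-> a' < next_cap k C a b o.
Proof.
move=> k1 C0 ->; rewrite /next_cap; split.
  by case: o => [|o] [h1 h2 h3 h4] /=; lia.
by case: o => [|o] /= h; split; lia.
Qed.

Section Levels.
Variable B : nat.

(* (f_{2t}, f_{bar 2t}, f_{bar 2t+1}, f_{2t+1}) *)
Definition level : Type := ('I_B * bool * bool * 'I_B)%type.

Definition ev (d : level) : nat := d.1.1.1.
Definition ev_bar (d : level) : bool := d.1.1.2.
Definition od_bar (d : level) : bool := d.1.2.
Definition od (d : level) : nat := d.2.

Definition level_weight (t : nat) (d : level) : nat :=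
  part_weight t (ev d) (od d) (ev_bar d) (od_bar d).

Fixpoint weight (t : nat) (s : seq level) : nat :=
  if s is d :: s' then level_weight t d + weight t.+1 s' else 0.

Fixpoint cap_ok (k C : nat) (s : seq level) : bool :=
  if s is d :: s' then
    (ev d < C) && cap_ok k (next_cap k C (ev d) (ev_bar d + od_bar d) (od d)) s'
  else 0 < C.

(** Listed in the order of [part_ge]: larger size first, the overlined copy before the plain
    ones. *)
Definition level_parts (t : nat) (d : level) : seq (nat * bool) :=
  nseq (od_bar d) ((2 * t).+1, true) ++ nseq (od d) ((2 * t).+1, false)
  ++ nseq (ev_bar d) (2 * t, true) ++ nseq (ev d) (2 * t, false).

Fixpoint parts_of (t : nat) (s : seq level) : seq (nat * bool) :=
  if s is d :: s' then parts_of t.+1 s' ++ level_parts t d else [::].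

Lemma mem_level_parts t d p : p \in level_parts t d -> 2 * t <= p.1 <= (2 * t).+1.
Proof.
rewrite !mem_cat !mem_nseq => /or4P[] /andP[_ /eqP->] /=; lia.
Qed.

Lemma mem_parts_of t s p : p \in parts_of t s -> 2 * t <= p.1.
Proof.
case: p => x b; elim: s t => //= d s IH t; rewrite mem_cat.
by case/orP=> [/IH|/mem_level_parts] /=; lia.
Qed.

Lemma mem_parts_of_lt t s p : p \in parts_of t s -> p.1 < 2 * (t + size s).
Proof.
case: p => x b; elim: s t => //= d s IH t; rewrite mem_cat.
by case/orP=> [/IH|/mem_level_parts] /=; lia.
Qed.

Lemma pairwise_nseq (T : Type) (e : rel T) n x :
  e x x || (n <= 1) -> pairwise e (nseq n x).
Proof.
elim: n => //= n IH h; rewrite IH ?andbT; last by case: (e x x) h => //=; lia.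
by rewrite all_nseq; case: n h {IH} => //= n; rewrite orbF.
Qed.

Lemma pairwise_parts_of t s : pairwise part_ge (parts_of t s).
Proof.
elim: s t => //= d s IH t; rewrite pairwise_cat IH andTb.
apply/andP; split.
  apply/allrelP => -[x b] [x' b'] /mem_parts_of /= hp /mem_level_parts /= hp'.
  by rewrite /part_ge /=; apply/orP; left; lia.
rewrite /level_parts !pairwise_cat !allrel_catr.
rewrite !pairwise_nseq ?leq_b1 ?orbT //; last first.
- by rewrite /part_ge eqxx orbT.
- by rewrite /part_ge eqxx orbT.
have nseq2 m n (p p' : nat * bool) : part_ge p p' ->
    allrel part_ge (nseq m p) (nseq n p').
  by move=> h; apply/allrelP => x x'; rewrite !mem_nseq => /andP[_ /eqP->] /andP[_ /eqP->].
by rewrite !nseq2 // /part_ge /= ?ltnSn ?eqxx ?orbT.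
Qed.

Lemma sum_nseq_parts n (p : nat * bool) : \sum_(x <- nseq n p) x.1 = n * p.1.
Proof. by elim: n => [|n IH]; rewrite /= ?big_nil // big_cons IH mulSn. Qed.

Lemma sum_parts_of t s : \sum_(p <- parts_of t s) p.1 = weight t s.
Proof.
elim: s t => [|d s IH] t; first by rewrite big_nil.
rewrite /= !big_cat /= IH !sum_nseq_parts addnC /level_weight /part_weight /=; lia.
Qed.

Lemma f_cat s l1 l2 : f s (l1 ++ l2) = f s l1 + f s l2.
Proof. exact: count_cat. Qed.

Lemma fbar_cat s l1 l2 : fbar s (l1 ++ l2) = fbar s l1 + fbar s l2.
Proof. exact: count_cat. Qed.

Lemma f_nseq s n p : f s (nseq n p) = ((p.1 == s) && ~~ p.2) * n.
Proof. by case: p => x b; rewrite /f count_nseq /= xpair_eqE eqbF_neg. Qed.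

Lemma fbar_nseq s n p : fbar s (nseq n p) = ((p.1 == s) && p.2) * n.
Proof. by case: p => x b; rewrite /fbar count_nseq /= xpair_eqE eqb_id. Qed.

Lemma level_parts_counts t d :
  [/\ f (2 * t) (level_parts t d) = ev d, f (2 * t + 1) (level_parts t d) = od d,
      fbar (2 * t) (level_parts t d) = ev_bar d
    & fbar (2 * t + 1) (level_parts t d) = od_bar d].
Proof.
by split; rewrite /level_parts ?(f_cat, fbar_cat) ?(f_nseq, fbar_nseq) /=; lia.
Qed.

Lemma count_parts_of_small s t x b : x < 2 * t ->
  count_mem (x, b) (parts_of t s) = 0.
Proof. by move=> xt; apply/count_memPn/negP => /mem_parts_of /=; lia. Qed.

Lemma count_level_parts_out u t d x b : t != u -> (x == 2 * u) || (x == 2 * u + 1) ->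
  count_mem (x, b) (level_parts t d) = 0.
Proof.
by move=> tu hx; apply/count_memPn/negP => /mem_level_parts /=; lia.
Qed.

Lemma parts_of_counts t s u d0 : u < size s ->
  [/\ f (2 * (t + u)) (parts_of t s) = ev (nth d0 s u),
      f (2 * (t + u) + 1) (parts_of t s) = od (nth d0 s u),
      fbar (2 * (t + u)) (parts_of t s) = ev_bar (nth d0 s u)
    & fbar (2 * (t + u) + 1) (parts_of t s) = od_bar (nth d0 s u)].
Proof.
elim: s t u => // d s IH t [_|u us] /=.
  have [h1 h2 h3 h4] := level_parts_counts t d.
  rewrite addn0 !(f_cat _ (parts_of _ _)) !(fbar_cat _ (parts_of _ _)) h1 h2 h3 h4.
  by rewrite /f /fbar !count_parts_of_small ?add0n //; lia.
have [h1 h2 h3 h4] := IH t.+1 u us.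
rewrite addnS -addSn !(f_cat _ (parts_of _ _)) !(fbar_cat _ (parts_of _ _)) h1 h2 h3 h4.
rewrite /f /fbar.
by rewrite !(@count_level_parts_out (t.+1 + u)) ?addn0 ?eqxx ?orbT //; lia.
Qed.
End Levels.

(** Level 0 has room for parts of size 0, which an overpartition does not have. *)
Definition no_zero_part B (s : seq (level B)) : bool :=
  if s is d :: _ then (ev d == 0) && ~~ ev_bar d else true.

Section LevelsOf.
Variables (B N : nat).

Definition level_of (t : nat) (l : seq (nat * bool)) : level B.+1 :=
  (inord (f (2 * t) l), 0 < fbar (2 * t) l, 0 < fbar (2 * t + 1) l,
   inord (f (2 * t + 1) l)).

Lemma ev_bar_level_of t (l : overpartition N) :
  ev_bar (level_of t l) = fbar (2 * t) l :> nat.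
Proof. by rewrite /ev_bar /=; have := fbar_le1 l (2 * t); lia. Qed.

Lemma od_bar_level_of t (l : overpartition N) :
  od_bar (level_of t l) = fbar (2 * t + 1) l :> nat.
Proof. by rewrite /od_bar /=; have := fbar_le1 l (2 * t + 1); lia. Qed.

Hypothesis NB : N <= B.

Lemma ev_level_of t (l : overpartition N) : ev (level_of t l) = f (2 * t) l.
Proof. by rewrite /ev /= inordK // ltnS (leq_trans (f_le _ _)). Qed.

Lemma od_level_of t (l : overpartition N) : od (level_of t l) = f (2 * t + 1) l.
Proof. by rewrite /od /= inordK // ltnS (leq_trans (f_le _ _)). Qed.

Variable n : nat.
Hypothesis Nn : N < 2 * n.

Definition levels_of (l : seq (nat * bool)) : n.-tuple (level B.+1) :=
  [tuple level_of t l | t < n].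

Lemma nth_levels_of l d0 t : t < n -> nth d0 (levels_of l) t = level_of t l.
Proof. by move=> tn; rewrite -[t]/(val (Ordinal tn)) -tnth_nth tnth_mktuple. Qed.

(** Both lists are sorted for the transitive antisymmetric relation [part_ge], so comparing
    multiplicities suffices. *)
Lemma parts_of_levels (l : overpartition N) : parts_of 0 (levels_of l) = l.
Proof.
apply: (sorted_eq part_ge_trans part_ge_anti).
- by rewrite (sorted_pairwise part_ge_trans) pairwise_parts_of.
- by case/and3P: (partsP l).
apply/allP => -[x b] _ /=; apply/eqP.
have [Nx|xN] := leqP (2 * n) x.
  rewrite (_ : count_mem _ l = 0); last first.
    by case: b; [apply: fbar_large | apply: f_large]; lia.
  by apply/count_memPn/negP => /mem_parts_of_lt; rewrite size_tuple card_ord /=; lia.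
have [u hu hx] : exists2 u, u < n & x = 2 * u \/ x = 2 * u + 1.
  by exists x./2; lia.
have := @parts_of_counts _ 0 (levels_of l) u (level_of 0 l).
rewrite size_tuple => /(_ hu) []; rewrite nth_levels_of // add0n.
rewrite ev_level_of od_level_of ev_bar_level_of od_bar_level_of.
by case: hx => ->; case: b.
Qed.

Lemma weight_levels (l : overpartition N) : weight 0 (levels_of l) = N.
Proof.
by rewrite -sum_parts_of parts_of_levels; case/and3P: (partsP l) => _ _ /eqP.
Qed.

Lemma no_zero_part_levels (l : overpartition N) : no_zero_part (levels_of l).
Proof.
have := @nth_levels_of l (level_of 0 l) 0.
case: (val (levels_of l)) => //= d s ->; last by lia.
by rewrite ev_level_of /ev_bar /= f_zero fbar_zero.
Qed.

Lemma levels_of_parts (s : n.-tuple (level B.+1)) :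
  no_zero_part s -> weight 0 s = N -> exists l : overpartition N, levels_of l = s.
Proof.
move=> ps ws; have h : is_overpartition N (parts_of 0 s).
  apply/and3P; split.
  - by rewrite (sorted_pairwise part_ge_trans) pairwise_parts_of.
  - case: (val s) ps => //= d s' /andP[/eqP ev0 evb0]; rewrite all_cat.
    apply/andP; split; first by apply/allP => -[x b] /mem_parts_of /=; lia.
    by rewrite /level_parts ev0 (negbTE evb0) /= !all_cat !all_nseq /= !orbT.
  - by rewrite sum_parts_of ws.
have n_gt0 : 0 < n by lia.
pose d0 : level B.+1 := level_of 0 [::].
exists (Overpartition h); apply: val_inj.
apply: (@eq_from_nth _ d0) => [|t]; rewrite !size_tuple // => tn.
rewrite nth_levels_of //=.
have := @parts_of_counts _ 0 s t d0; rewrite size_tuple add0n => /(_ tn) [].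
rewrite /level_of /= => -> -> -> ->.
case: (nth d0 s t) => [[[a be] ga] o] /=.
by rewrite /ev /od /ev_bar /od_bar /= !inord_val !lt0b.
Qed.

Lemma card_overpartition (Pr : pred (n.-tuple (level B.+1))) :
  #|[set l : overpartition N | Pr (levels_of l)]|
  = #|[set s : n.-tuple (level B.+1) | [&& no_zero_part s, weight 0 s == N & Pr s]]|.
Proof.
have inj : injective (fun l : overpartition N => levels_of l).
  move=> l1 l2 E; apply: val_inj.
  by rewrite /= -(parts_of_levels l1) -(parts_of_levels l2) E.
rewrite -(card_imset _ inj); apply: eq_card => s; rewrite inE.
apply/imsetP/idP => [[l + ->]|/and3P[ps /eqP ws Ps]].
  by rewrite inE => ->; rewrite no_zero_part_levels weight_levels eqxx.
by have [l ls] := levels_of_parts ps ws; exists l; rewrite // inE ls.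
Qed.
End LevelsOf.

(* conditions (2)-(5) *)
Definition cond_at (k i : nat) (l : seq (nat * bool)) (t : nat) : Prop :=
  [/\ f (2 * t) l + fbar (2 * t) l + fbar (2 * t + 1) l + f (2 * t + 2) l <= k - 1,
      f (2 * t + 1) l >= 1 -> f (2 * t + 2) l <= k - 2,
      f (2 * t) l + fbar (2 * t) l + fbar (2 * t + 1) l + f (2 * t + 2) l = k - 1 ->
      t * f (2 * t) l + t * fbar (2 * t) l + t * fbar (2 * t + 1) l
        + (t + 1) * f (2 * t + 2) l = V (2 * t + 1) l + i - 1 %[mod 2]
    & f (2 * t + 1) l >= 1 -> f (2 * t + 2) l = k - 2 ->
      t + (t + 1) * f (2 * t + 2) l = V (2 * t + 1) l + i - 1 %[mod 2]].

Lemma eq_mod2 a b : (a = b %[mod 2]) <-> (odd a = odd b).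
Proof. by rewrite !modn2; case: (odd a) (odd b) => [] []. Qed.

(** * Conditions (1)-(5) as a run of the cap automaton *)

Section Conditions.
Variables (k i : nat).
Hypotheses (i_gt0 : 0 < i) (ik : i < k).

(** Invariant of the run: [C] is the cap on f_{2t+2}, and the parity of C - 1 stores all that (4)
    and (5) need from the earlier levels. An empty cap stores nothing, hence the guard. *)
Definition cap_parity (l : seq (nat * bool)) (t C : nat) : Prop :=
  0 < C -> odd C.-1 = odd (V (2 * t + 1) l + i.-1 + t * k.-1).

Lemma cond_at_cap l t C (s := t.+1)
    (C' := next_cap k C (f (2 * s) l) (fbar (2 * s) l + fbar (2 * s + 1) l)
             (f (2 * s + 1) l)) :
  f (2 * s) l < C -> cap_parity l t C ->
  (cond_at k i l s <-> f (2 * s.+1) l < C') /\ cap_parity l s C'.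
Proof.
move=> aC par.
have VE : V (2 * s + 1) l = V (2 * t + 1) l + fbar (2 * s) l + fbar (2 * s + 1) l.
  rewrite addn1 VS (_ : 2 * s = (2 * t + 1).+1); last by rewrite /s; lia.
  by rewrite VS addn1.
have C0 : 0 < C by lia.
have {}par := par C0.
have ds : 2 * s + 2 = 2 * s.+1 by lia.
rewrite /cond_at ds {}/C'.
move: (f (2 * s) l) (fbar (2 * s) l) (fbar (2 * s + 1) l) (f (2 * s + 1) l) aC VE.
move: (f (2 * s.+1) l) => a' a be ga o aC VE.
set e := odd (C.-1 + (be + ga) + k.-1).
have eE : e = odd (V (2 * s + 1) l + i.-1 + s * k.-1).
  by rewrite VE /s (mulSn t k.-1) /e -addnA oddD par -oddD; congr odd; lia.
split; last first.
  move=> C'0; rewrite -eE /e; move: C'0; rewrite /next_cap.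
  by case: o {par} eE => [|o] /= _; lia.
have k1 : 1 < k by lia.
rewrite -(cap_step a o a' k1 C0 (erefl e)).
have ViE : V (2 * s + 1) l + i - 1 = V (2 * s + 1) l + i.-1 by lia.
(* When b + a' = k - 1, the weighted sum s b + (s + 1) a' equals s (k - 1) + a', so (4) prescribes
   the parity of a'. Condition (5) is the case b = 1. *)
have key b : b + a' = k - 1 -> (s * b + (s + 1) * a' = V (2 * s + 1) l + i - 1 %[mod 2])
    <-> (odd a' = e).
  move=> h; rewrite eq_mod2 ViE eE.
  have -> : s * b + (s + 1) * a' = s * k.-1 + a'.
    by rewrite (_ : k.-1 = b + a') ?mulnDl ?mul1n ?mulnDr ?addnA //; lia.
  rewrite (oddD (_ * _) a') (oddD _ (s * k.-1)).
  by case: (odd (s * _)) (odd (V _ _ + _)) (odd a') => [] [] [].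
have key1 : a' = k - 2 -> (s + (s + 1) * a' = V (2 * s + 1) l + i - 1 %[mod 2])
    <-> odd a' = e.
  by move=> h; rewrite -[X in X + _](muln1 s); apply: key; lia.
have key3 : a + be + ga + a' = k - 1 ->
    (s * a + s * be + s * ga + (s + 1) * a' = V (2 * s + 1) l + i - 1 %[mod 2])
    <-> odd a' = e by move=> h; rewrite -!mulnDr; apply: key.
rewrite addnA; split=> -[h1 h2 h3 h4]; split=> //.
- by move=> h; apply/(key3 h)/h3.
- by move=> o1 h; apply/(key1 h)/h4.
- by move=> h; apply/(key3 h)/h3.
- by move=> o1 h; apply/(key1 h)/h4.
Qed.

Lemma cond_at_trivial (N : nat) (l : overpartition N) t : N < 2 * t -> cond_at k i l t.
Proof.
move=> Nt; rewrite /cond_at !f_large ?fbar_large; try lia.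
by split; lia.
Qed.

Lemma cap_ok_levels (B N : nat) (l : overpartition N) t m C :
  N <= B -> N < 2 * (t.+1 + m) -> cap_parity l t C ->
  cap_ok k C [seq level_of B u l | u <- iota t.+1 m]
  <-> f (2 * t.+1) l < C /\ forall u, t < u -> cond_at k i l u.
Proof.
move=> NB; elim: m t C => [|m IH] t C Nt par /=.
  (* All parts are smaller than 2(t+1) here, so the remaining conditions hold trivially. *)
  rewrite f_large; last by lia.
  split=> [C0|[]//]; split=> // u tu; apply: cond_at_trivial; lia.
rewrite ev_level_of // od_level_of // ev_bar_level_of od_bar_level_of.
split.
  move=> /andP[aC].
  have [hc par'] := cond_at_cap aC par.
  rewrite IH //; last by lia.
  move=> [/hc h1 h2]; split=> // u; rewrite leq_eqVlt => /orP[/eqP<- //|]; exact: h2.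
move=> [aC hu]; rewrite aC /=.
have [hc par'] := cond_at_cap aC par.
rewrite IH //; last by lia.
by split; [apply/hc/hu | move=> u tu; apply: hu; lia].
Qed.

Lemma O_condition_levels (B N n : nat) (l : overpartition N) : N <= B -> N < 2 * n.+1 ->
  O_condition k i l
  <-> cap_ok k (i - od_bar (level_of B 0 l)) [seq level_of B u l | u <- iota 1 n].
Proof.
move=> NB Nn.
have b1 := fbar_le1 l 1.
rewrite od_bar_level_of muln0 add0n cap_ok_levels //; last first.
  by rewrite /cap_parity muln0 add0n mul0n addn0 VS V0 fbar_zero => h; lia.
have -> : O_condition k i l <-> fbar 1 l + f 2 l <= i - 1 /\ forall u, cond_at k i l u.
  split=> [h|[h1 h2] t]; first by split=> [|u]; [case: (h 0) | case: (h u)].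
  by case: (h2 t).
split=> [[h1 h2]|[h1 h2]]; first by split; [rewrite muln1; lia | move=> u _; apply: h2].
rewrite muln1 in h1; split=> [|[|u]]; [by lia | | exact: h2].
(* At t = 0 everything follows from (1): the sum in (2) is at most i - 1 <= k - 2, so (4) is
   vacuous, and in (5) the equality f_2 = k - 2 forces i = k - 1 and the absence of an overlined
   1. *)
rewrite /cond_at !muln0 !add0n f_zero fbar_zero !addn0 VS V0 fbar_zero.
split; [lia | lia | lia |] => f1 f2.
rewrite eq_mod2; lia.
Qed.
End Conditions.

(** * The residue condition on non-overlined parts *)

Section PSide.
Variables (B r c : nat).

Fixpoint allowed_levels (t : nat) (s : seq (level B)) : bool :=
  if s is d :: s' then
    [&& (0 < ev d) ==> allowed r c (2 * t), (0 < od d) ==> allowed r c (2 * t + 1)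
      & allowed_levels t.+1 s']
  else true.

End PSide.

Lemma P_condition_allowed r C (l : seq (nat * bool)) : C < r ->
  P_condition r.+1 C.+1 l <-> forall s, 0 < f s l -> allowed r (2 * C).+1 s.
Proof.
move=> Cr; rewrite /P_condition.
have Er : (4 * r.+1%:Z - 4 = (4 * r)%:Z)%R by lia.
have Ec : (2 * C.+1%:Z - 1 = (2 * C).+1%:Z)%R by lia.
have EN : (- (2 * C).+1%:Z = (4 * r - (2 * C).+1)%N%:Z - (4 * r)%:Z)%R by lia.
rewrite Er Ec.
have En : (- (2 * C).+1%:Z %% (4 * r)%:Z)%Z = (4 * r - (2 * C).+1)%N%:Z%R.
  rewrite EN; have := modzDr ((4 * r - (2 * C).+1)%N%:Z - (4 * r)%:Z)%R (4 * r)%:Z%R.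
  by rewrite subrK => <-; rewrite modz_nat modn_small //; lia.
have hs s : ([/\ (s%:Z <> 0 %[mod (4 * r)%:Z])%Z, (s%:Z <> (2 * C).+1 %[mod (4 * r)%:Z])%Z
    & (s%:Z <> - (2 * C).+1%:Z %[mod (4 * r)%:Z])%Z]) <-> allowed r (2 * C).+1 s.
  rewrite En /allowed mod0z !modz_nat (@modn_small (2 * C).+1); last by lia.
  split=> [[h1 h2 h3]|/and3P[/eqP h1 /eqP h2 /eqP h3]]; last by split=> -[].
  by apply/and3P; split; apply/eqP => h; [apply: h1 | apply: h2 | apply: h3]; rewrite h.
have hf s : ((s, false) \in l) = (0 < f s l) by rewrite -has_pred1 has_count.
by split=> h s; [rewrite -hf => /h/hs | rewrite hf => /h/hs].
Qed.

Lemma P_condition_levels B N n r C (l : overpartition N) : C < r ->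
  N <= B -> N < 2 * n ->
  P_condition r.+1 C.+1 l <-> allowed_levels r (2 * C).+1 0 [seq level_of B u l | u <- iota 0 n].
Proof.
move=> Cr NB Nn; rewrite P_condition_allowed //; set c := (2 * C).+1.
have gen m t : allowed_levels r c t [seq level_of B u l | u <- iota t m]
    <-> forall s, 2 * t <= s < 2 * (t + m) -> 0 < f s l -> allowed r c s.
  elim: m t => [|m IH] t /=; first by split=> // _ s; lia.
  rewrite ev_level_of // od_level_of //; split.
    move=> /and3P[/implyP h1 /implyP h2 /IH h3] s hs.
    have [->|[->|hs']] : s = 2 * t \/ s = 2 * t + 1 \/ 2 * t.+1 <= s < 2 * (t.+1 + m) by lia.
    + exact: h1.
    + exact: h2.
    + exact: h3.
  move=> h; apply/and3P; split; [apply/implyP/h; lia | apply/implyP/h; lia |].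
  by apply/IH => s hs; apply: h; lia.
rewrite gen; split=> h s; first by move=> _; apply: h.
have [Ns|sN] := ltnP N s; first by rewrite f_large.
by apply: h; lia.
Qed.

Local Open Scope ring_scope.

(** * Sums over tuples of levels *)

Lemma sum_tupleS (V : nmodType) (D : finType) n (P : pred (seq D)) (F : seq D -> V) :
  \sum_(s : n.+1.-tuple D | P s) F s
  = \sum_(d : D) \sum_(s : n.-tuple D | P (d :: s)) F (d :: s).
Proof.
rewrite pair_big_dep /=.
rewrite (reindex (fun p : D * n.-tuple D => [tuple of p.1 :: p.2])) //=.
exists (fun s : n.+1.-tuple D => (thead s, [tuple of behead s])) => [[d s] _|s _] /=.
  by congr (_, _); apply: val_inj.
by rewrite [RHS]tuple_eta; apply: val_inj.
Qed.

Lemma sum_tuple0 (V : nmodType) (D : finType) (P : pred (seq D)) (F : seq D -> V) :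
  \sum_(s : 0.-tuple D | P s) F s = if P [::] then F [::] else 0.
Proof.
rewrite (eq_bigl (fun=> P [::])) => [|s]; last by rewrite tuple0.
rewrite (eq_bigr (fun=> F [::])) => [|s _]; last by rewrite tuple0.
case: (P [::]); last by rewrite big_pred0.
by rewrite sumr_const card_tuple expn0.
Qed.

Lemma sum_level (V : nmodType) B (F : level B -> V) :
  \sum_d F d = \sum_(a < B) \sum_(be : bool) \sum_(ga : bool) \sum_(o < B) F (a, be, ga, o).
Proof.
by rewrite !pair_bigA /=; apply: eq_bigr => -[[[a be] ga] o].
Qed.

Section TupleGf.
Variables (K : fieldType) (q : K) (r B : nat).

(** The bounds keep every cap at most B, so the sum over a < C can be widened to all multiplicities
    that a level can store. *)
Lemma cap_gf_tuple f C t : (r < B)%N -> (C <= B)%N ->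
  cap_gf q r B f C t = \sum_(s : f.-tuple (level B) | cap_ok r.+1 C s) q ^+ weight t s.
Proof.
move=> rB; elim: f C t => [|f IH] C t CB.
  by rewrite (sum_tuple0 (cap_ok r.+1 C) (fun s => q ^+ weight t s)) /=; case: C {CB}.
rewrite (sum_tupleS f (cap_ok r.+1 C) (fun s => q ^+ weight t s)) sum_level /=.
rewrite (big_ord_widen_cond B xpredT (fun a => \sum_(be : bool) \sum_(ga : bool) \sum_(o < B)
  q ^+ part_weight t a o be ga * cap_gf q r B f (next_cap r.+1 C a (be + ga) o) t.+1)) //.
rewrite big_mkcond /=; apply: eq_bigr => a _.
rewrite {1}/ev /=; case: ifP => aC; last first.
  apply/esym; rewrite big1 // => be _; rewrite big1 // => ga _; rewrite big1 // => o _.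
  by rewrite big_pred0 // => s; rewrite /= /ev /= aC.
apply: eq_bigr => be _; apply: eq_bigr => ga _; apply: eq_bigr => o _.
rewrite IH; last by rewrite /next_cap; lia.
rewrite mulr_sumr; apply: eq_big => s; first by [].
by rewrite /= exprD.
Qed.
End TupleGf.

(** * Generating functions over sequences of levels *)

Definition O_levels B (r C : nat) (s : seq (level B)) : bool :=
  if s is d :: s' then
    [&& ev d == 0, ~~ ev_bar d & cap_ok r.+1 (C.+1 - od_bar d) s']%N
  else false.

Definition P_levels B (r C : nat) (s : seq (level B)) : bool :=
  no_zero_part s && allowed_levels r (2 * C).+1 0 s.

Section TotalGf.
Variables (K : fieldType) (q : K) (r B C f : nat).
Hypothesis rB : (r < B.+1)%N.
Hypothesis Cr : (C < r)%N.

Lemma sum_first_level (F : level B.+1 -> K) :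
  \sum_(d | (ev d == 0)%N && ~~ ev_bar d) F d
  = \sum_(ga : bool) \sum_(o < B.+1) F (ord0, false, ga, o).
Proof.
rewrite big_mkcond sum_level (bigD1 ord0) //= [X in _ + X]big1 ?addr0.
  rewrite big_bool /= big1 ?add0r // => ga _.
  by rewrite big1.
move=> a a0; rewrite big1 // => be _; rewrite big1 // => ga _; rewrite big1 // => o _.
by rewrite /ev /= -val_eqE in a0 *; rewrite (negbTE a0).
Qed.

Lemma O_levels_gf :
  \sum_(s : f.+1.-tuple (level B.+1) | O_levels r C s) q ^+ weight 0 s
  = geom q B.+1 0 * (cap_gf q r B.+1 f C.+1 1 + q * cap_gf q r B.+1 f C 1).
Proof.
rewrite (sum_tupleS f (@O_levels _ r C) (fun s => q ^+ weight 0 s)) /=.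
transitivity (\sum_(d : level B.+1 | (ev d == 0)%N && ~~ ev_bar d)
   q ^+ level_weight 0 d * cap_gf q r B.+1 f (C.+1 - od_bar d) 1).
  rewrite [RHS]big_mkcond; apply: eq_bigr => d _; case: ifP => h; last first.
    by rewrite big_pred0 // => s; rewrite andbA h.
  rewrite cap_gf_tuple //; last by lia.
  rewrite mulr_sumr; apply: eq_big => s; first by rewrite andbA h.
  by rewrite exprD.
rewrite sum_first_level big_bool /= /geom mulrDr addrC !mulr_suml.
congr (_ + _); apply: eq_bigr => o _; rewrite ?subSS ?subn0.
  by rewrite -exprM; congr (q ^+ _ * _).
rewrite mulrA -exprM -exprSr; congr (q ^+ _ * _).
Qed.

Variables (O : subringClosed K) (N : nat).
Hypothesis q_neq0 : q != 0.
Hypothesis Oq : q \in O.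
Hypothesis qm : forall j, (0 < j)%N -> 1 - q ^+ j != 0.
Hypothesis Om : forall j, (0 < j)%N -> (1 - q ^+ j)^-1 \in O.
Hypothesis NB : (N <= B.+1)%N.
Let c := (2 * C).+1.

Definition part_gf (s : nat) : K :=
  \sum_(a < B.+1 | (0 < a)%N ==> allowed r c s) (q ^+ s) ^+ a.

Lemma part_gf0 : part_gf 0 = 1.
Proof.
rewrite /part_gf /allowed mod0n eqxx /= (big_pred1 ord0) ?expr0 // => a.
by rewrite /= -val_eqE /= implybF -eqn0Ngt.
Qed.

Lemma part_gf_eqq s : (0 < s)%N ->
  eqq q O N ((1 + q ^+ s) * part_gf s) (gfactor q r c s).
Proof.
move=> s0; apply: eqqMl; first by rewrite rpredD ?rpred1 ?rpredX.
rewrite /part_gf; case: ifP => hs.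
  rewrite (eq_bigl xpredT) => [|a]; last by rewrite implybT.
  exact: (eqq_leq q_neq0 Oq NB (geom_series_eqq q_neq0 Oq qm Om B.+1 s0)).
rewrite (big_pred1 ord0) ?expr0 ?eqq_refl // => a.
by rewrite /= -val_eqE /= implybF -eqn0Ngt.
Qed.

Lemma part_gf_in s : part_gf s \in O.
Proof. by apply: rpred_sum => a _; rewrite !rpredX. Qed.

(** [A] constrains the overlined even part: it is [negb] at level 0, to exclude an overlined 0, and
    trivial at the other levels. *)
Lemma level_gf t (A : pred bool) :
  \sum_(d : level B.+1 | [&& (0 < ev d)%N ==> allowed r c (2 * t),
                            (0 < od d)%N ==> allowed r c (2 * t + 1)
                          & A (ev_bar d)]) q ^+ level_weight t d
  = part_gf (2 * t) * ((\sum_(be : bool | A be) q ^+ (2 * t * be))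
    * ((1 + q ^+ (2 * t + 1)) * part_gf (2 * t + 1))).
Proof.
have -> : 1 + q ^+ (2 * t + 1) = \sum_(ga : bool) q ^+ ((2 * t + 1) * ga).
  by rewrite big_bool /= muln0 muln1 expr0 addrC.
rewrite big_mkcond sum_level /part_gf.
rewrite [\sum_(a < _ | _ ==> allowed r c (2 * t)) _]big_mkcond /=.
rewrite [\sum_(be | A be) _]big_mkcond /=.
rewrite [\sum_(a < _ | _ ==> allowed r c (2 * t + 1)) _]big_mkcond /=.
rewrite mulr_suml; apply: eq_bigr => a _.
rewrite mulr_suml mulr_sumr; apply: eq_bigr => be _.
rewrite mulr_suml !mulr_sumr; apply: eq_bigr => ga _.
rewrite !mulr_sumr; apply: eq_bigr => o _.
rewrite /ev /od /ev_bar /=.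
case: (_ ==> allowed r c (2 * t)); rewrite ?mul0r //.
case: (A be); rewrite ?andbF ?mul0r ?mulr0 //.
case: (_ ==> allowed r c (2 * t + 1)); rewrite ?mulr0 //=.
rewrite -!exprM -!exprD; congr (_ ^+ _).
by rewrite /level_weight /part_weight /ev /od /ev_bar /od_bar /=; lia.
Qed.

Lemma levels_gf m t : (0 < t)%N ->
  eqq q O N (\sum_(s : m.-tuple (level B.+1) | allowed_levels r c t s) q ^+ weight t s)
    (\prod_(2 * t <= s < 2 * (t + m)) gfactor q r c s).
Proof.
elim: m t => [|m IH] t t0.
  rewrite (sum_tuple0 (@allowed_levels B.+1 r c t) (fun s => q ^+ weight t s)) /=.
  by rewrite addn0 big_geq // eqq_refl.
rewrite (sum_tupleS m (@allowed_levels B.+1 r c t) (fun s => q ^+ weight t s)) /=.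
have -> : \sum_(d : level B.+1) \sum_(s : m.-tuple (level B.+1)
      | [&& (0 < ev d)%N ==> allowed r c (2 * t),
            (0 < od d)%N ==> allowed r c (2 * t + 1) & allowed_levels r c t.+1 s])
      q ^+ (level_weight t d + weight t.+1 s)
  = (\sum_(d : level B.+1 | [&& (0 < ev d)%N ==> allowed r c (2 * t),
            (0 < od d)%N ==> allowed r c (2 * t + 1) & true]) q ^+ level_weight t d)
    * \sum_(s : m.-tuple (level B.+1) | allowed_levels r c t.+1 s) q ^+ weight t.+1 s.
  rewrite [in RHS]big_mkcond mulr_suml; apply: eq_bigr => d _.
  case: (_ ==> allowed r c (2 * t)) => /=; last by rewrite mul0r big_pred0.
  case: (_ ==> allowed r c (2 * t + 1)) => /=; last by rewrite mul0r big_pred0.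
  by rewrite mulr_sumr; apply: eq_bigr => s _; rewrite exprD.
rewrite (level_gf t xpredT) big_bool /= muln0 muln1 expr0.
rewrite big_ltn; last lia.
rewrite big_ltn; last lia.
rewrite (_ : (2 * t).+2 = 2 * t.+1)%N; last lia.
rewrite (_ : t + m.+1 = t.+1 + m)%N; last lia.
set S := \sum_(s : m.-tuple _ | _) _.
have -> : part_gf (2 * t) * ((q ^+ (2 * t) + 1) *
    ((1 + q ^+ (2 * t + 1)) * part_gf (2 * t + 1))) * S
  = (1 + q ^+ (2 * t)) * part_gf (2 * t)
    * ((1 + q ^+ (2 * t + 1)) * part_gf (2 * t + 1) * S) by ring.
have Ogf u : (0 < u)%N -> gfactor q r c u \in O by apply: gfactor_in.
have Oprod : \prod_(2 * t.+1 <= s < 2 * (t.+1 + m)) gfactor q r c s \in O.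
  by rewrite big_nat; apply: rpred_prod => s hs; apply: Ogf; lia.
apply: eqqM.
- by rewrite rpredM ?part_gf_in ?rpredD ?rpred1 ?rpredX.
- by rewrite rpredM ?Ogf.
- by apply: part_gf_eqq; lia.
apply: eqqM; rewrite ?IH //.
- by rewrite rpredM ?part_gf_in ?rpredD ?rpred1 ?rpredX.
- by rewrite -(addn1 (2 * t)); apply: part_gf_eqq; lia.
Qed.

Lemma P_levels_gf :
  eqq q O N (\sum_(s : f.+1.-tuple (level B.+1) | P_levels r C s) q ^+ weight 0 s)
    (\prod_(1 <= s < 2 * f.+1) gfactor q r c s).
Proof.
rewrite (sum_tupleS f (@P_levels B.+1 r C) (fun s => q ^+ weight 0 s)).
set S := \sum_(s : f.-tuple (level B.+1) | allowed_levels r c 1 s) q ^+ weight 1 s.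
have -> : \sum_(d : level B.+1) \sum_(s : f.-tuple (level B.+1) | P_levels r C (d :: s))
      q ^+ weight 0 (d :: s)
  = (\sum_(d : level B.+1 | [&& (0 < ev d)%N ==> allowed r c (2 * 0),
            (0 < od d)%N ==> allowed r c (2 * 0 + 1) & ~~ ev_bar d])
      q ^+ level_weight 0 d) * S.
  have al0 : allowed r c 0 = false by rewrite /allowed mod0n.
  rewrite [in RHS]big_mkcond mulr_suml; apply: eq_bigr => d _.
  rewrite /P_levels /= muln0 al0 implybF -eqn0Ngt.
  case: (ev d == 0)%N => /=; last by rewrite mul0r big_pred0.
  case: (ev_bar d) => /=; first by rewrite andbF mul0r big_pred0.
  case: (_ ==> allowed r c (0 + 1)) => /=; last by rewrite mul0r big_pred0.
  by rewrite mulr_sumr; apply: eq_bigr => s _; rewrite exprD.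
rewrite (level_gf 0 negb) big_mkcond big_bool /= muln0 part_gf0 !mul0n expr0 !mul1r add0r mul1r.
rewrite big_ltn; last lia.
have Oprod : \prod_(2 <= s < 2 * f.+1) gfactor q r c s \in O.
  by rewrite big_nat; apply: rpred_prod => s hs; apply: gfactor_in => //; lia.
apply: eqqM => //.
- by rewrite rpredM ?part_gf_in ?rpredD ?rpred1 ?rpredX.
- exact: part_gf_eqq.
- exact: levels_gf.
Qed.
End TotalGf.

(** * Specialization to rational functions over the rationals *)

Local Notation ratfrac := {fraction {poly rat}}.
Local Notation "x %:F" := (@FracField.tofrac {poly rat} x).
Local Notation q := ('X%:F : ratfrac).

(* the local ring of rational functions without pole at 0 *)
Definition regular_at0 (a : ratfrac) : bool :=
  `[< exists p r : {poly rat}, r.[0] != 0 /\ a = p%:F / r%:F >].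

Lemma tofrac_horner_neq0 (r : {poly rat}) : r.[0] != 0 -> r%:F != 0.
Proof. by rewrite tofrac_eq0; apply: contraNneq => ->; rewrite horner0. Qed.

Lemma regular_at0_subring : subring_closed regular_at0.
Proof.
split=> [|a b|a b]; rewrite ?inE.
- by apply/asboolP; exists 1, 1; rewrite hornerC oner_neq0 tofrac1 divr1.
- move=> /asboolP[p [r [r0 ->]]] /asboolP[p' [r' [r0' ->]]].
  apply/asboolP; exists (p * r' - p' * r), (r * r').
  rewrite hornerM mulf_neq0 // tofracB !tofracM -mulNr addf_div ?tofrac_horner_neq0 //.
  by rewrite mulNr.
- move=> /asboolP[p [r [r0 ->]]] /asboolP[p' [r' [r0' ->]]].
  apply/asboolP; exists (p * p'), (r * r').
  by rewrite hornerM mulf_neq0 // !tofracM invfM mulrACA.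
Qed.

HB.instance Definition _ := GRing.isSubringClosed.Build ratfrac regular_at0
  regular_at0_subring.

Lemma regularV (r : {poly rat}) : r.[0] != 0 -> r%:F^-1 \in regular_at0.
Proof. by move=> r0; apply/asboolP; exists 1, r; rewrite tofrac1 mul1r. Qed.

Definition regular_ring : subringClosed ratfrac :=
  GRing.SubringClosed.clone ratfrac regular_at0 _.

(** If d / X^(N+1) = p / r with r(0) nonzero, then X^(N+1) divides d r, hence d, because X is
    coprime to r. *)
Lemma vge_tofrac N (d : {poly rat}) : vge q regular_ring N.+1 d%:F -> d`_N = 0.
Proof.
move=> /asboolP[p [r [r0 /eqP E]]].
have XF : q ^+ N.+1 != 0 by rewrite expf_neq0 // tofrac_eq0 polyX_eq0.
rewrite eqr_div ?tofrac_horner_neq0 // -tofracXn -!tofracM tofrac_eq in E.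
have : dvdp 'X^(N.+1) (d * r) by rewrite (eqP E) dvdp_mull.
rewrite Gauss_dvdpl; last first.
  by rewrite coprimep_sym coprimep_expr // coprimepX /root.
by move=> /dvdpP[u ->]; rewrite coefMXn ltnSn.
Qed.

Lemma regular_q_neq0 : q != 0.
Proof. by rewrite tofrac_eq0 polyX_eq0. Qed.

Lemma regular_q_in : q \in regular_ring.
Proof. by apply/asboolP; exists 'X, 1; rewrite hornerC oner_neq0 tofrac1 divr1. Qed.

Lemma one_subX_horner j : (0 < j)%N -> (1 - 'X^j : {poly rat}).[0] != 0.
Proof. by case: j => // j _; rewrite hornerD hornerN hornerXn hornerC expr0n subr0 oner_neq0. Qed.

Lemma one_addX_horner j : (0 < j)%N -> (1 + 'X^j : {poly rat}).[0] != 0.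
Proof. by case: j => // j _; rewrite hornerD hornerXn hornerC expr0n addr0 oner_neq0. Qed.

Lemma one_subq j : 1 - q ^+ j = (1 - 'X^j)%:F.
Proof. by rewrite tofracB tofrac1 tofracXn. Qed.

Lemma one_addq j : 1 + q ^+ j = (1 + 'X^j)%:F.
Proof. by rewrite tofracD tofrac1 tofracXn. Qed.

(** The coefficient of q^N counts the elements of weight N, and a congruence modulo q^(N+1)
    determines it. *)
Lemma count_of_gf (I : finType) (P P' : pred I) (w : I -> nat) N :
  eqq q regular_ring N.+1 (\sum_(s | P s) q ^+ w s) (\sum_(s | P' s) q ^+ w s) ->
  #|[set s | P s & w s == N]| = #|[set s | P' s & w s == N]|.
Proof.
have gfE (A : pred I) : \sum_(s | A s) q ^+ w s = (\sum_(s | A s) 'X^(w s))%:F.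
  by rewrite rmorph_sum; apply: eq_bigr => s _; rewrite /= tofracXn.
have coefE (A : pred I) :
    (\sum_(s | A s) 'X^(w s) : {poly rat})`_N = #|[set s | A s & w s == N]|%:R.
  rewrite coef_sum -sum1dep_card natr_sum big_mkcondr /=; apply: eq_bigr => s _.
  by rewrite coefXn eq_sym; case: eqP.
rewrite /eqq !gfE -tofracB => /vge_tofrac/eqP.
by rewrite coefB !coefE subr_eq0 eqr_nat => /eqP.
Qed.

Local Open Scope nat_scope.

Theorem theorem1p12 (k i n : nat) (hi : 1 <= i) (hik : i < k) :
  O_tilde k i n = P_tilde k i n.
Proof.
case: i hi hik => // C _; case: k => // r; rewrite ltnS => Cr.
(* [B] is at least every multiplicity, and B + 1 is at least every cap, these being at most r + 1.
   The choice of [f] makes 2(f+2) equal to m + 1 periods of length 4r. *)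
pose B := n + r; pose m := n.+1; pose f := (m.+1 * (2 * r)).-2.
have fE : f.+2 = m.+1 * (2 * r) by rewrite /f; nia.
have nB : n <= B by rewrite leq_addr.
have rB : r < B.+1 by rewrite ltnS leq_addl.
have nf : n < 2 * f.+1 by nia.
have valE (l : overpartition n) :
    val (levels_of B f.+1 l) = [seq level_of B t l | t <- iota 0 f.+1].
  by rewrite -[iota 0 f.+1]val_enum_ord -map_comp.
have OE : O_tilde r.+1 C.+1 n
    = #|[set s : f.+1.-tuple (level B.+1) | O_levels r C s & weight 0 s == n]|.
  rewrite -[LHS](_ : #|[set l : overpartition n | O_levels r C (levels_of B f.+1 l)]| = _).
    rewrite (card_overpartition nB nf (fun s => O_levels r C s)).
    apply: eq_card => s; rewrite !inE; case: (val s) => [|d s'] /=; first by rewrite andbF.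
    by case: (ev d == 0); case: (ev_bar d) => //=; rewrite andbC.
  apply: eq_card => l; rewrite !inE valE /=.
  rewrite ev_level_of // f_zero /ev_bar /= fbar_zero /=.
  apply/idP/asboolP.
    by move=> /(O_condition_levels (isT : 0 < C.+1) (Cr : C.+1 < r.+1) l nB nf).
  by move=> /(O_condition_levels (isT : 0 < C.+1) (Cr : C.+1 < r.+1) l nB nf).
have PE : P_tilde r.+1 C.+1 n
    = #|[set s : f.+1.-tuple (level B.+1) | P_levels r C s & weight 0 s == n]|.
  rewrite -[LHS](_ : #|[set l : overpartition n | P_levels r C (levels_of B f.+1 l)]| = _).
    rewrite (card_overpartition nB nf (fun s => P_levels r C s)).
    apply: eq_card => s; rewrite !inE.
    by rewrite /P_levels; case: (no_zero_part s) => //=; rewrite andbC.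
  apply: eq_card => l; rewrite !inE /P_levels no_zero_part_levels // valE.
  by apply/idP/asboolP => /(P_condition_levels l Cr nB nf).
rewrite OE PE; apply: count_of_gf.
have qm j : 0 < j -> (1 - q ^+ j != 0)%R.
  by move=> j0; rewrite one_subq tofrac_horner_neq0 ?one_subX_horner.
have qp j : 0 < j -> (1 + q ^+ j != 0)%R.
  by move=> j0; rewrite one_addq tofrac_horner_neq0 ?one_addX_horner.
have Om j : 0 < j -> ((1 - q ^+ j)^-1)%R \in regular_ring.
  by move=> j0; rewrite one_subq regularV ?one_subX_horner.
have Op j : 0 < j -> ((1 + q ^+ j)^-1)%R \in regular_ring.
  by move=> j0; rewrite one_addq regularV ?one_addX_horner.
rewrite O_levels_gf //.
have r_gt0 : 0 < r by lia.
have nB1 : n.+1 <= B.+1 by [].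
apply: (eqq_trans (O_gf_product regular_q_neq0 regular_q_in qm qp Om Op r_gt0
  (leqnn m) nB1 (ltn0Sn B) Cr fE)).
apply: eqq_sym.
exact: (P_levels_gf f rB Cr regular_q_neq0 regular_q_in qm Om nB1).
Qed.
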